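(* Let $K_1$ be the set of points of $[0,1]$ whose base $10^{9000}$ expansions contain only digits in $\{0,\dots,10^{8100}-1\}$. There is an integer $l\geq 0$ such that there are infinitely many $t>0$ for which the fractional parts of \[ 10^{9000l}t,\quad 10^{9000l}t^2,\quad 10^{9000l}t^3 \] all lie in $K_1$. Moreover, the upper box dimension of the set of such numbers $t\in[0,1]$ lies in $[1/30,7/10]$.
   Context: The fractional part of a real number $x$ is $\{x\}=x-\lfloor x\rfloor\in[0,1)$. For a bounded set $F\subset\mathbb{R}^n$, let $N_\delta(F)$ be the minimal number of $\delta$-balls needed to cover $F$; the upper box dimension is $\overline{\dim}_{\mathrm{B}}F=\limsup_{\delta\to0}\frac{\log N_\delta(F)}{-\log\delta}$. *)

(* Defs.v *)
From mathcomp Require Import all_boot all_order all_algebra.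
From mathcomp Require Import all_classical all_reals all_analysis.

Set Implicit Arguments.
Unset Strict Implicit.
Unset Printing Implicit Defensive.

Import Order.TTheory GRing.Theory Num.Theory.
Import numFieldNormedType.Exports.

Local Open Scope classical_set_scope.
Local Open Scope ring_scope.

Definition frac_part (R : realType) (x : R) : R := x - (Num.floor x)%:~R.

(* A point with two base b expansions belongs to the set as soon as one of
   them uses only digits smaller than m; this gives the self-similar set. *)
Definition digit_set (R : realType) (b m : nat) : set R :=
  [set x : R | 0 <= x <= 1 /\
    exists d : nat -> nat, (forall k, (d k < m)%N) /\
      series (fun k => (d k)%:R / b%:R ^+ k.+1) @ \oo --> x].

(* The centres of the balls need not belong to F.  The value is +oo when no
   finite family of balls covers F; otherwise the infimum is attained. *)
Definition covering_number (R : realType) (T : pseudoMetricType R)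
    (F : set T) (delta : R) : \bar R :=
  ereal_inf [set (n%:R)%:E | n in [set n : nat |
    exists c : 'I_n -> T, F `<=` \bigcup_(i in [set: 'I_n]) ball (c i) delta]].

(* lne 0 = -oo, so the empty set has dimension -oo. *)
Definition upper_box_dim (R : realType) (T : pseudoMetricType R)
    (F : set T) : \bar R :=
  limf_esup (fun delta : R =>
    (lne (covering_number F delta) * ((- ln delta)^-1)%:E)%E) (0 : R)^'+.

Definition K1 (R : realType) : set R :=
  digit_set (10 ^ 9000)%N (10 ^ 8100)%N.

(* Main.v *)
(* With l = 0 and t < 1 the theorem concerns the t in [0, 1) for which t, t^2
   and t^3 have only digits below M = 10^8100 in base B = 10^9000.

   Upper bound.  Put N = B^n.  Majorise the 1/N-neighbourhood of the level n
   digit points by a sum of Fejer kernels, evaluate it at a/N, (a/N)^2, (a/N)^3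
   and sum over a < N.  In Fourier space this is a sum over (h1, h2, h3) of
   products of digit exponential sums times the exponential sum of the phase
   h1 a/N + h2 (a/N)^2 + h3 (a/N)^3.  The latter is O(N |h|^(-1/3)) (van der
   Corput, by Kusmin-Landau), while the l^1 norm of the digit sums over
   |h_i| < B^m is M^n (B/M)^m up to a factor (log B)^m.  As
   3 (1 - 9/10) = 3/10 < 1/3, the zero frequency dominates and at most a
   constant times M^(3n) / N^2 = N^(7/10) of the intervals [a/N, (a+1)/N) meet
   the set.

   Lower bound.  Write A = 10^300, so B = A^30, and start from
   u = B t = 1 + A^(-6) + ... .  Since 2 u and 3 u^2 are nearly 2 + 2 A^(-6) and
   3 + 6 A^(-6) + 3 A^(-12), the next digit of u can be chosen in at least A^2
   ways so that the fractional parts of B^n u^2 and B^n u^3 stay small at every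
   level.  This gives A^(2m) points of the set that are B^(-m-3)-separated. *)

Require Import Defs.
From mathcomp Require Import all_boot all_order all_algebra.
From mathcomp Require Import all_classical all_reals all_analysis.
From mathcomp Require Import complex ring lra zify.

Set Implicit Arguments.
Unset Strict Implicit.
Unset Printing Implicit Defensive.

Import Order.TTheory GRing.Theory Num.Theory.
Import numFieldNormedType.Exports.
Local Open Scope classical_set_scope.
Local Open Scope ring_scope.

(** * Complex exponentials *)

Section Exponential.
Variable R : realType.
Local Notation C := R[i].

(** Infinitude is the easy half: every positive integer [t] has fractional parts 0. The dimension
    bounds carry the content.

    For the upper bound, the exponent 1/3 must hold uniformly in the direction of (h1, h2, h3), so
    no single derivative of the phase may be assumed large. The increments of a cubic phase are a
    quadratic polynomial in [a]: if it is small at three well separated integers, interpolation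
    makes all three coefficients small. Few terms therefore have small increments, and Kusmin-Landau
    treats the rest. Frequencies stay below N/100, so increments stay in [-1/2, 1/2] and no
    reduction modulo 1 occurs.

    Passing from |h| < B^m to |h| < B^(m+1) gains B^(1/3 - 3/10) = B^(1/30) against a loss of order
    (log B)^3. The loss recurs at every level, so the base has to be large; 10^9000 leaves ample
    room.

    For the lower bound, one digit must steer two fractional parts at once. The shift by A^(-6)
    makes this triangular: a multiple k A^6 in the digit moves the square by nearly an integer and
    the cube by about 3 k A^(-6) modulo 1. *)

Definition cmod (z : C) : R := Num.sqrt (complex.Re z ^+ 2 + complex.Im z ^+ 2).

Lemma normC_cmod z : `|z| = (cmod z)%:C%C.
Proof. by rewrite normc_def. Qed.

Lemma cmod_ge0 z : 0 <= cmod z.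
Proof. exact: sqrtr_ge0. Qed.

Lemma cmodM x y : cmod (x * y) = cmod x * cmod y.
Proof. by apply: complexI; rewrite rmorphM /= -!normC_cmod normrM. Qed.

Lemma cmodD x y : cmod (x + y) <= cmod x + cmod y.
Proof. by rewrite -lecR rmorphD /= -!normC_cmod ler_normD. Qed.

Lemma cmodN x : cmod (- x) = cmod x.
Proof. by apply: complexI; rewrite -!normC_cmod normrN. Qed.

Lemma cmodB x y : cmod (x - y) = cmod (y - x).
Proof. by rewrite -cmodN opprB. Qed.

Lemma cmod0 : cmod 0 = 0.
Proof. by apply: complexI; rewrite -!normC_cmod normr0. Qed.

Lemma cmodV x : cmod x^-1 = (cmod x)^-1.
Proof. by apply: complexI; rewrite fmorphV /= -!normC_cmod normfV. Qed.

Lemma cmod_conj (x : C) : cmod (x^*)%C = cmod x.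
Proof. by case: x => a b; rewrite /cmod /= sqrrN. Qed.

Lemma cmod_eq0 x : (cmod x == 0) = (x == 0).
Proof. by rewrite -(normr_eq0 x) normC_cmod -(inj_eq (@complexI R)). Qed.

Lemma cmod_sum (I : Type) (r : seq I) (P : pred I) (F : I -> C) :
  cmod (\sum_(i <- r | P i) F i) <= \sum_(i <- r | P i) cmod (F i).
Proof.
elim/big_rec2: _ => [|i y x _ le_xy]; first by rewrite cmod0.
by apply: le_trans (cmodD _ _) _; rewrite lerD2l.
Qed.

Lemma cmod_prod (I : Type) (r : seq I) (P : pred I) (F : I -> C) :
  cmod (\prod_(i <- r | P i) F i) = \prod_(i <- r | P i) cmod (F i).
Proof.
apply: (big_morph cmod cmodM).
by apply: complexI; rewrite -normC_cmod normr1.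
Qed.

Lemma mulC_conj (x : C) : x * (x^*)%C = (cmod x ^+ 2)%:C%C.
Proof.
case: x => a b; rewrite /cmod sqr_sqrtr ?addr_ge0 ?sqr_ge0 //=.
by apply/eqP; rewrite eq_complex /=; apply/andP; split; apply/eqP; ring.
Qed.

Definition e (x : R) : C := Complex (cos (pi *+ 2 * x)) (sin (pi *+ 2 * x)).

Lemma e0 : e 0 = 1.
Proof. by rewrite /e mulr0 cos0 sin0. Qed.

Lemma eD x y : e (x + y) = e x * e y.
Proof.
by rewrite /e mulrDr cosD sinD; apply/eqP; rewrite eq_complex /=;
   apply/andP; split; apply/eqP; ring.
Qed.

Lemma e_conj x : ((e x)^*)%C = e (- x).
Proof. by rewrite /e mulrN cosN sinN. Qed.

Lemma cmod_e x : cmod (e x) = 1.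
Proof. by rewrite /cmod /= cos2Dsin2 sqrtr1. Qed.

Lemma e1 : e 1 = 1.
Proof. by rewrite /e mulr1 cos2pi sin2pi. Qed.

Lemma e_nat n : e n%:R = 1.
Proof. by elim: n => [|n IH]; rewrite ?e0 // -natr1 eD IH e1 mul1r. Qed.

Lemma e_mulrn x n : e (n%:R * x) = e x ^+ n.
Proof.
elim: n => [|n IH]; first by rewrite mul0r e0.
by rewrite -natr1 mulrDl mul1r eD IH exprSr.
Qed.

Lemma e_sum (I : Type) (r : seq I) (P : pred I) (F : I -> R) :
  e (\sum_(i <- r | P i) F i) = \prod_(i <- r | P i) e (F i).
Proof. exact: (big_morph e eD e0). Qed.

Lemma cmod_e_sub1 x : cmod (e x - 1) = 2 * `|sin (pi * x)|.
Proof.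
have -> : 2 * `|sin (pi * x)| = Num.sqrt ((2 * sin (pi * x)) ^+ 2).
  by rewrite sqrtr_sqr normrM ger0_norm.
rewrite /cmod /e (mulrnAl pi x) cos_mulr2n sin_mulr2n.
have := cos2Dsin2 (pi * x); set c := cos _; set s := sin _ => h /=.
congr Num.sqrt; rewrite oppr0 addr0 !mulr2n.
have s2 : s ^+ 2 = 1 - c ^+ 2 by rewrite -h; ring.
transitivity ((2 * c ^+ 2 - 2) ^+ 2 + 4 * c ^+ 2 * s ^+ 2); first by ring.
by rewrite exprMn s2; ring.
Qed.

Lemma sin_mvt (x : R) : 0 <= x -> exists2 c, 0 <= c <= x & sin x = cos c * x.
Proof.
move=> x0; have [c cx] : exists2 c, c \in `[0, x]%R &
    sin x - sin 0 = cos c * (x - 0).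
  apply: MVT_segment => //.
  by apply: continuous_subspaceT => y; exact: continuous_sin.
by rewrite sin0 !subr0 => ->; exists c.
Qed.

Lemma norm_sin_le (x : R) : `|sin x| <= `|x|.
Proof.
wlog x0 : x / 0 <= x => [hw|].
  have [/hw //|/ltW x0] := lerP 0 x.
  by rewrite -normrN -sinN -[leRHS]normrN hw // oppr_ge0.
have [c _ ->] := sin_mvt x0; rewrite normrM -[leRHS]mul1r.
by rewrite ler_wpM2r // cos_max.
Qed.

(** Halving the angle replaces a concavity argument: in sin x = 2 cos(x/2) sin(x/2), the mean value
    theorem turns sin(x/2) into cos c times x/2, and both cosines are at least cos(pi/4), whose
    square is 1/2. *)
Lemma sin_ge_chord (x : R) : 0 <= x <= pi / 2 -> x / 2 <= sin x.
Proof.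
move=> /andP[x0 xpi]; have p0 := pi_gt0 R.
pose k : R := cos (pi / 4).
have k0 : 0 <= k by apply: cos_ge0_pihalf; apply/andP; split; lra.
have kk : k * k = 1 / 2.
  have := cos_mulr2n (pi / 4 : R).
  have -> : (pi / 4 : R) *+ 2 = pi / 2 by rewrite mulr2n; field.
  rewrite cos_pihalf -/k expr2 mulr2n; lra.
have cosk (y : R) : 0 <= y <= x / 2 -> k <= cos y.
  move=> /andP[y0 yx]; have [->//|ne] := eqVneq y (pi / 4).
  apply: ltW; rewrite ltr_cos ?in_itv /=; first by rewrite lt_neqAle ne /=; lra.
    by apply/andP; split; lra.
  by apply/andP; split; lra.
have [c cx sE] := @sin_mvt (x / 2) ltac:(lra).
have kc := cosk _ cx.
have kx : k <= cos (x / 2) by apply: cosk; lra.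
have -> : sin x = 2 * (cos (x / 2) * sin (x / 2)).
  by rewrite -[in LHS](_ : (x / 2) *+ 2 = x) ?sin_mulr2n ?mulr2n; [ring|field].
rewrite sE.
have : k * (k * (x / 2)) <= cos (x / 2) * (cos c * (x / 2)).
  by apply: ler_pM => //; rewrite ?mulr_ge0 ?ler_wpM2r //; lra.
by rewrite mulrA kk; lra.
Qed.

Lemma e_lip x : cmod (e x - 1) <= 8 * `|x|.
Proof.
rewrite cmod_e_sub1; apply: le_trans (_ : 2 * `|pi * x| <= _).
  by rewrite ler_pM2l // norm_sin_le.
rewrite normrM mulrA ler_wpM2r // ger0_norm ?pi_ge0 //.
(* The constant 8 is a crude bound for 2 pi. *)
have := pihalf_lt2 R; lra.
Qed.

Lemma e_lip2 x y : cmod (e x - e y) <= 8 * `|x - y|.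
Proof.
have -> : e x - e y = e y * (e (x - y) - 1).
  by rewrite mulrBr mulr1 -eD [y + _]addrC subrK.
by rewrite cmodM cmod_e mul1r e_lip.
Qed.

Lemma e_lower x : `|x| <= 1 / 2 -> 2 * `|x| <= cmod (e x - 1).
Proof.
move=> xle; rewrite cmod_e_sub1.
have -> : `|sin (pi * x)| = `|sin (pi * `|x|)|.
  by case: (ger0P x) => // _; rewrite mulrN sinN normrN.
move: `|x| (normr_ge0 x) xle => y y0 y1.
have p2 := pi_ge2 R.
apply: le_trans (_ : 2 * sin (pi * y) <= _); last first.
  by rewrite ler_pM2l // ler_norm.
have := @sin_ge_chord (pi * y).
have -> : 0 <= pi * y <= pi / 2 by apply/andP; split; nra.
move=> /(_ isT); nra.
Qed.

Lemma cmod_geometric x n : cmod (\sum_(d < n) e (d%:R * x)) * cmod (e x - 1) <= 2.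
Proof.
rewrite mulrC -cmodM; under eq_bigr do rewrite e_mulrn.
rewrite -subrX1 -e_mulrn; apply: le_trans (cmodD _ _) _.
rewrite cmodN cmod_e; have -> : cmod 1 = 1 by rewrite -e0 cmod_e.
by [].
Qed.

End Exponential.

(** * The Kusmin-Landau inequality *)

(** Summation by parts. The boundary term [E n.+1 * c n] is kept on the left so that going from [n]
    to [n.+1] changes the left side by exactly [- E n.+1 * (c n.+1 - c n)]. *)
Lemma abel_bound (R : realType) (E c : nat -> R[i]) (n : nat) :
  (forall a, cmod (E a) = 1) ->
  cmod (\sum_(0 <= a < n.+1) (E a.+1 - E a) * c a - E n.+1 * c n)
    <= cmod (c 0%N) + \sum_(0 <= a < n) cmod (c a.+1 - c a).
Proof.
move=> E1; elim: n => [|n IH].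
  rewrite big_nat1 big_geq // addr0.
  have -> : (E 1%N - E 0%N) * c 0%N - E 1%N * c 0%N = - (E 0%N * c 0%N) by ring.
  by rewrite cmodN cmodM E1 mul1r.
rewrite big_nat_recr //= [in leRHS]big_nat_recr //= addrA.
have -> : \sum_(0 <= i < n.+1) (E i.+1 - E i) * c i + (E n.+2 - E n.+1) * c n.+1
   - E n.+2 * c n.+1 = (\sum_(0 <= i < n.+1) (E i.+1 - E i) * c i - E n.+1 * c n)
   + - (E n.+1 * (c n.+1 - c n)) by ring.
apply: le_trans (cmodD _ _) _; apply: lerD => //.
by rewrite cmodN cmodM E1 mul1r.
Qed.

Section KusminLandau.
Variables (R : realType) (lam : R).
Hypothesis lam0 : 0 < lam.
Implicit Types g : nat -> R.

Local Notation D g a := (g a.+1 - g a).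

(** Each term is a difference: [e (g a) = (e (g a.+1) - e (g a)) * c a] with [c a] the inverse of
    [e (D g a) - 1]. Summation by parts leaves the variation of [c], which is dominated by that of
    [2 / D g a]; as the increments are monotone and of constant sign, this telescopes. The variation
    contributes 4/lam and the two boundary terms 1/(2 lam) each. *)
Lemma kusmin_landau0 g n :
  (forall a, (a < n)%N -> lam <= `|D g a| <= 1 / 2) ->
  (forall a, (a < n)%N -> 0 < D g a) \/ (forall a, (a < n)%N -> D g a < 0) ->
  (forall a, (a.+1 < n)%N -> D g a <= D g a.+1) ->
  cmod (\sum_(0 <= a < n) e (g a)) <= 5 / lam.
Proof.
have lp := lam0; case: n => [|n] hD hs hm.
  by rewrite big_geq // cmod0 divr_ge0 // ltW.
pose c a := (e (D g a) - 1)^-1.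
have nz a : (a < n.+1)%N -> 0 < cmod (e (D g a) - 1).
  move=> an; have /andP[h1 h2] := hD _ an.
  by have := e_lower h2; lra.
have cle a : (a < n.+1)%N -> cmod (c a) <= (2 * `|D g a|)^-1.
  move=> an; have /andP[h1 h2] := hD _ an.
  rewrite cmodV lef_pV2 ?posrE ?nz //; first exact: e_lower.
  by rewrite mulr_gt0 //; lra.
have cle' a : (a < n.+1)%N -> cmod (c a) <= 1 / 2 / lam.
  move=> an; have /andP[h1 h2] := hD _ an.
  apply: le_trans (cle _ an) _.
  have -> : 1 / 2 / lam = (2 * lam)^-1 by field; rewrite gt_eqF.
  by rewrite lef_pV2 ?posrE ?mulr_gt0 //; lra.
have -> : \sum_(0 <= a < n.+1) e (g a) =
    \sum_(0 <= a < n.+1) (e (g a.+1) - e (g a)) * c a.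
  apply: eq_big_nat => a /andP[_ an].
  have -> : e (g a.+1) - e (g a) = e (g a) * (e (D g a) - 1).
    by rewrite mulrBr mulr1 -eD [g a + _]addrC subrK.
  by rewrite mulfK // -cmod_eq0 gt_eqF ?nz.
have step a : (a.+1 < n.+1)%N ->
    cmod (c a.+1 - c a) <= 2 * ((D g a)^-1 - (D g a.+1)^-1).
  move=> an; have an' : (a < n.+1)%N by apply: ltnW.
  have /andP[h1 h2] := hD _ an; have /andP[h3 h4] := hD _ an'.
  have Dm := hm _ an.
  have z1 := nz _ an; have z2 := nz _ an'.
  have w1 : D g a.+1 != 0 by rewrite -normr_gt0; lra.
  have w2 : D g a != 0 by rewrite -normr_gt0; lra.
  have Dp : 0 < D g a * D g a.+1.
    by case: hs => hs; [apply: mulr_gt0|rewrite nmulr_rgt0]; apply: hs.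
  (* The difference of inverses brings out [e (D g a) - e (D g a.+1)], Lipschitz with constant 8,
     while each factor [c] costs at most 1/(2 |D|): altogether 8/4 = 2. *)
  have -> : c a.+1 - c a = (e (D g a) - e (D g a.+1)) * c a * c a.+1.
    have y1 : e (D g a) - 1 != 0 by rewrite -cmod_eq0 gt_eqF.
    have y2 : e (D g a.+1) - 1 != 0 by rewrite -cmod_eq0 gt_eqF.
    rewrite /c; move: (e (D g a)) (e (D g a.+1)) y1 y2 => p q y1 y2.
    by field; rewrite y1 y2.
  rewrite !cmodM.
  have -> : 2 * ((D g a)^-1 - (D g a.+1)^-1) =
      8 * `|D g a - D g a.+1| * (2 * `|D g a|)^-1 * (2 * `|D g a.+1|)^-1.
    rewrite -mulrA -invfM mulrACA -normrM (gtr0_norm Dp) distrC ger0_norm ?subr_ge0 //.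
    by field; rewrite w1 w2.
  apply: ler_pM; rewrite ?mulr_ge0 ?cmod_ge0 ?cle //.
  by apply: ler_pM; rewrite ?cmod_ge0 ?cle ?e_lip2.
have tel : \sum_(0 <= a < n) cmod (c a.+1 - c a) <= 4 / lam.
  apply: le_trans (_ : \sum_(0 <= a < n) 2 * ((D g a)^-1 - (D g a.+1)^-1) <= _).
    by rewrite big_nat [leRHS]big_nat; apply: ler_sum => a /andP[_ an]; apply: step.
  rewrite -mulr_sumr.
  have -> : \sum_(0 <= a < n) ((D g a)^-1 - (D g a.+1)^-1) = (D g 0%N)^-1 - (D g n)^-1.
    rewrite -[LHS]opprK -sumrN; under eq_bigr do rewrite opprB.
    by rewrite (telescope_sumr (fun a => (D g a)^-1)) // opprB.
  have inv a : (a < n.+1)%N -> `|(D g a)^-1| <= lam^-1.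
    move=> an; have /andP[h1 h2] := hD _ an.
    by rewrite normfV lef_pV2 ?posrE //; lra.
  have := inv 0%N isT; have := inv n (leqnn _).
  rewrite !ler_norml => /andP[? ?] /andP[? ?]; lra.
have := abel_bound c n (fun a => cmod_e (g a)).
set S := \sum_(0 <= a < n.+1) _ => h.
have -> : S = (S - e (g n.+1) * c n) + e (g n.+1) * c n by rewrite subrK.
apply: le_trans (cmodD _ _) _; rewrite cmodM cmod_e mul1r.
have := cle' 0%N isT; have := cle' n (leqnn _); lra.
Qed.

Lemma kusmin_landau g u v : (u <= v)%N ->
  (forall a, (u <= a < v)%N -> lam <= `|D g a| <= 1 / 2) ->
  (forall a, (u <= a < v)%N -> 0 < D g a) \/ (forall a, (u <= a < v)%N -> D g a < 0) ->
  (forall a, (u <= a)%N -> (a.+1 < v)%N -> D g a <= D g a.+1) ->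
  cmod (\sum_(u <= a < v) e (g a)) <= 5 / lam.
Proof.
move=> uv hD hs hm; rewrite -{1}[u]add0n big_addn.
apply: (@kusmin_landau0 (fun a => g (a + u)%N)) => [a an||a an] /=.
- exact: (hD (a + u)%N ltac:(lia)).
- by case: hs => hs; [left|right] => a an; apply: (hs (a + u)%N); lia.
- exact: (hm (a + u)%N ltac:(lia) ltac:(lia)).
Qed.

(** Used to cut a range of summation at the place where a monotone sequence crosses a threshold. *)
Lemma monotone_threshold (p : pred nat) u v : (u <= v)%N ->
  (forall a, (u <= a)%N -> (a.+1 < v)%N -> p a -> p a.+1) ->
  exists i, [/\ (u <= i <= v)%N, forall a, (u <= a < i)%N -> ~~ p a &
                forall a, (i <= a < v)%N -> p a].
Proof.
elim: v => [|v IH] uv hp.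
  by exists u; split=> [|a ha|a ha]; [lia|exfalso; lia|exfalso; lia].
case: (ltngtP u v.+1) uv => // [uv _|-> _]; last first.
  by exists v.+1; split=> [|a ha|a ha]; [lia|exfalso; lia|exfalso; lia].
have [|a ua av|i [iv h1 h2]] := IH _.
- by lia.
- by apply: hp; lia.
have [pv|npv] := boolP (p v).
  exists i; split=> // [|a /andP[ia av]]; first by lia.
  by have [->//|ne] := eqVneq a v; apply: h2; lia.
exists v.+1; split=> [|a /andP[ua av]|a ha]; [lia| |exfalso; lia].
have [->//|ne] := eqVneq a v.
apply: contra npv => pa.
have: forall k, (a + k <= v)%N -> p (a + k)%N.
  elim=> [|k IHk] hk; first by rewrite addn0.
  by rewrite addnS; apply: hp; [lia|lia|apply: IHk; lia].
by move=> /(_ (v - a)%N); rewrite subnKC; [apply; lia|lia].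
Qed.

(** Counts the terms that will be estimated trivially; for the cubic phase their number is bounded
    separately, by interpolation. *)
Definition small_count g u v : R := \sum_(u <= a < v) ((`|D g a| < lam)%R : nat)%:R.

Lemma small_count_ge0 g u v : 0 <= small_count g u v.
Proof. by apply: sumr_ge0 => a _; rewrite ler0n. Qed.

Lemma small_count_cat g u i v : (u <= i <= v)%N ->
  small_count g u v = small_count g u i + small_count g i v.
Proof. by move=> /andP[? ?]; rewrite /small_count (big_cat_nat _ _ (n := i)). Qed.

Lemma small_count_full g u v : (forall a, (u <= a < v)%N -> `|D g a| < lam) ->
  cmod (\sum_(u <= a < v) e (g a)) <= small_count g u v.
Proof.
move=> h; apply: le_trans (cmod_sum _ _ _) _.
rewrite big_nat /small_count [leRHS]big_nat; apply: ler_sum => a ha.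
by rewrite h // cmod_e.
Qed.

(** Rising increments cross -lam and then lam, which cuts the range into three stretches:
    Kusmin-Landau gives 5/lam on each outer one, and the middle one consists of small increments
    only. *)
Lemma e_sum_monotone g u v : (u <= v)%N ->
  (forall a, (u <= a < v)%N -> `|D g a| <= 1 / 2) ->
  (forall a, (u <= a)%N -> (a.+1 < v)%N -> D g a <= D g a.+1) ->
  cmod (\sum_(u <= a < v) e (g a)) <= small_count g u v + 10 / lam.
Proof.
have lp := lam0; move=> uv hD hm.
have [a ua av|i [iv i1 i2]] := @monotone_threshold (fun a => - lam < D g a) u v uv.
  by have := hm _ ua av; lra.
have [|a ia av|j [jv j1 j2]] := @monotone_threshold (fun a => lam <= D g a) i v.
- by lia.
- by have := hm a ltac:(lia) av; lra.
rewrite (big_cat_nat _ _ (n := i)) /=; [|lia|lia].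
rewrite (big_cat_nat _ _ (m := i) (n := j)) /=; [|lia|lia].
rewrite (@small_count_cat g u i v); last by lia.
rewrite (@small_count_cat g i j v); last by lia.
have h1 : cmod (\sum_(u <= a < i) e (g a)) <= 5 / lam.
  apply: kusmin_landau => [|a ha||a ua ai]; first by lia.
  - rewrite hD ?andbT; last by lia.
    by have := i1 _ ha; rewrite -leNgt => h; rewrite ler0_norm; lra.
  - by right=> a ha; have := i1 _ ha; rewrite -leNgt => h; lra.
  - by apply: hm; lia.
have h3 : cmod (\sum_(j <= a < v) e (g a)) <= 5 / lam.
  apply: kusmin_landau => [|a ha||a ua ai]; first by lia.
  - rewrite hD ?andbT; last by lia.
    by have := j2 _ ha => h; rewrite ger0_norm; lra.
  - by left=> a ha; have := j2 _ ha => h; lra.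
  - by apply: hm; lia.
have h2 : cmod (\sum_(i <= a < j) e (g a)) <= small_count g i j.
  apply: small_count_full => a ha; rewrite ltr_norml.
  by have := j1 _ ha; rewrite -ltNge => ->; rewrite andbT; apply: i2; lia.
apply: le_trans (cmodD _ _) _.
have := cmodD (\sum_(i <= a < j) e (g a)) (\sum_(j <= a < v) e (g a)).
have := small_count_ge0 g u i; have := small_count_ge0 g j v; lra.
Qed.

Lemma e_sum_conj g u v :
  cmod (\sum_(u <= a < v) e (- g a)) = cmod (\sum_(u <= a < v) e (g a)).
Proof.
rewrite -[RHS]cmod_conj rmorph_sum /=; congr cmod.
by apply: eq_bigr => a _; rewrite -e_conj.
Qed.

Lemma small_count_opp g u v : small_count (fun a => - g a) u v = small_count g u v.
Proof.
by apply: eq_bigr => a _; rewrite -opprD normrN.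
Qed.

(** Conjugation negates the phase: falling increments become rising ones, and neither side of the
    bound changes. *)
Lemma e_sum_antitone g u v : (u <= v)%N ->
  (forall a, (u <= a < v)%N -> `|D g a| <= 1 / 2) ->
  (forall a, (u <= a)%N -> (a.+1 < v)%N -> D g a.+1 <= D g a) ->
  cmod (\sum_(u <= a < v) e (g a)) <= small_count g u v + 10 / lam.
Proof.
move=> uv hD hm; rewrite -e_sum_conj -small_count_opp.
apply: e_sum_monotone => // a => [ha|ua av].
  by rewrite -opprD normrN; apply: hD.
by rewrite -!opprD lerN2 hm.
Qed.

(** Nondecreasing second differences change sign at most once, so the increments fall on an initial
    stretch and rise on the remaining one. This is the shape of a cubic phase with nonnegative
    leading coefficient. *)
Lemma e_sum_convex g v :
  (forall a, (a < v)%N -> `|D g a| <= 1 / 2) ->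
  (forall a b, (a <= b)%N -> D g a.+1 - D g a <= D g b.+1 - D g b) ->
  cmod (\sum_(0 <= a < v) e (g a)) <= small_count g 0 v + 20 / lam.
Proof.
move=> hD hm.
have [|a ua av|i [iv i1 i2]] :=
  @monotone_threshold (fun a => 0 <= D g a.+1 - D g a) 0 v.
- by [].
- by have := hm a a.+1 (leqnSn _); lra.
rewrite (big_cat_nat _ _ (n := i)) //= (@small_count_cat g 0 i v) //.
apply: le_trans (cmodD _ _) _.
have h1 : cmod (\sum_(0 <= a < i) e (g a)) <= small_count g 0 i + 10 / lam.
  apply: e_sum_antitone => // a => [ha|_ ai]; first by apply: hD; lia.
  by have := i1 a ltac:(lia); rewrite -ltNge; lra.
have h2 : cmod (\sum_(i <= a < v) e (g a)) <= small_count g i v + 10 / lam.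
  apply: e_sum_monotone => [|a ha|a ua ai]; [lia|by apply: hD; lia|].
  by have := i2 a ltac:(lia); lra.
lra.
Qed.

End KusminLandau.

(** * Exponential sums along the moment curve *)

(** In the increasing list of the points satisfying [p], ranks that differ by [s] belong to points
    at least [s] apart; ranks 0, [s] and 2 [s] are taken. *)
Lemma three_spread_points (p : pred nat) N s : (0 < s)%N ->
  (2 * s < count p (index_iota 0 N))%N ->
  exists a0 a1 a2, [/\ p a0, p a1 & p a2] /\
    [/\ (a0 + s <= a1)%N, (a1 + s <= a2)%N & (a2 < N)%N].
Proof.
move=> s0; rewrite -size_filter; set r := seq.filter _ _ => hr.
have mem i : (i < size r)%N -> p (nth 0%N r i) /\ (nth 0%N r i < N)%N.
  move=> /(mem_nth 0%N); rewrite mem_filter mem_index_iota => /andP[-> /andP[_ ->]].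
  by [].
have srt : sorted ltn r.
  by apply: (sorted_filter ltn_trans); exact: iota_ltn_sorted.
have gap i k : (i + k < size r)%N -> (nth 0%N r i + k <= nth 0%N r (i + k))%N.
  elim: k => [|k IH] h; first by rewrite !addn0.
  apply: leq_trans (_ : (nth 0%N r (i + k)).+1 <= _)%N.
    by rewrite addnS ltnS IH //; lia.
  by apply: (sorted_ltn_nth ltn_trans 0%N srt); rewrite ?inE; lia.
exists (nth 0%N r 0), (nth 0%N r (0 + s)), (nth 0%N r (0 + s + s)).
have [p0 _] := mem 0%N ltac:(lia); have [p1 _] := mem (0 + s)%N ltac:(lia).
have [p2 ?] := mem (0 + s + s)%N ltac:(lia).
by split; split=> //; apply: gap; lia.
Qed.

Section Curve.
Variable R : realType.

(** Interpolation: [m1] and [m2] are the divided differences over the two gaps, at most [2 lam / s];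
    their difference divided by [x2 - x0], which is at least [2 s], is [ga]. Then [be] is recovered
    from [m1], and [al] from the value at [x0]. *)
Lemma quadratic_coef_bound (al be ga lam N s x0 x1 x2 : R) :
  0 < lam -> 0 < s <= N -> 0 <= x0 -> x2 <= N -> x0 + s <= x1 -> x1 + s <= x2 ->
  `|al + be * x0 + ga * x0 ^+ 2| < lam ->
  `|al + be * x1 + ga * x1 ^+ 2| < lam ->
  `|al + be * x2 + ga * x2 ^+ 2| < lam ->
  [/\ `|ga| * N ^+ 2 <= 2 * (lam * (N / s) ^+ 2),
      `|be| * N <= 6 * (lam * (N / s) ^+ 2) &
      `|al| <= 9 * (lam * (N / s) ^+ 2)].
Proof.
move=> lam0 /andP[s0 sN] x00 x2N h01 h12.
rewrite !ltr_norml => /andP[a1 a2] /andP[b1 b2] /andP[c1 c2].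
set k := N / s; have k1 : 1 <= k by rewrite ler_pdivlMr ?mul1r.
have NE : N = k * s by rewrite mulfVK ?gt_eqF.
pose m1 := be + ga * (x0 + x1); pose m2 := be + ga * (x1 + x2).
have m1E : `|m1| <= 2 * lam / s.
  rewrite ler_pdivlMr //; apply: le_trans (_ : `|m1| * (x1 - x0) <= _).
    by rewrite ler_wpM2l //; lra.
  have {1}-> : x1 - x0 = `|x1 - x0| by rewrite ger0_norm //; lra.
  rewrite -normrM.
  have -> : m1 * (x1 - x0) = (al + be * x1 + ga * x1 ^+ 2) -
                             (al + be * x0 + ga * x0 ^+ 2) by rewrite /m1; ring.
  by rewrite ler_norml; apply/andP; split; lra.
have m2E : `|m2| <= 2 * lam / s.
  rewrite ler_pdivlMr //; apply: le_trans (_ : `|m2| * (x2 - x1) <= _).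
    by rewrite ler_wpM2l //; lra.
  have {1}-> : x2 - x1 = `|x2 - x1| by rewrite ger0_norm //; lra.
  rewrite -normrM.
  have -> : m2 * (x2 - x1) = (al + be * x2 + ga * x2 ^+ 2) -
                             (al + be * x1 + ga * x1 ^+ 2) by rewrite /m2; ring.
  by rewrite ler_norml; apply/andP; split; lra.
have gE : `|ga| <= 2 * (lam / s ^+ 2).
  have -> : 2 * (lam / s ^+ 2) = (2 * lam / s + 2 * lam / s) / (2 * s).
    by field; rewrite gt_eqF.
  rewrite ler_pdivlMr ?mulr_gt0 //; apply: le_trans (_ : `|ga| * (x2 - x0) <= _).
    by rewrite ler_wpM2l //; lra.
  have {1}-> : x2 - x0 = `|x2 - x0| by rewrite ger0_norm //; lra.
  rewrite -normrM.
  have -> : ga * (x2 - x0) = m2 - m1 by rewrite /m1 /m2; ring.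
  by apply: le_trans (ler_normB _ _) _; apply: lerD.
have L : lam / s ^+ 2 * N ^+ 2 = lam * k ^+ 2.
  by rewrite NE; field; rewrite gt_eqF.
have gE' : `|ga| * N ^+ 2 <= 2 * (lam * k ^+ 2).
  by rewrite -L mulrA ler_wpM2r ?sqr_ge0.
have Y0 : 0 < lam * k ^+ 2 by rewrite mulr_gt0 // exprn_gt0 //; lra.
have lamY : lam <= lam * k ^+ 2 by rewrite ler_peMr // ?exprn_ege1 // ltW.
have N0 : 0 < N by lra.
have bE : `|be| * N <= 6 * (lam * k ^+ 2).
  have -> : be = m1 - ga * (x0 + x1) by rewrite /m1; ring.
  apply: le_trans (_ : (`|m1| + `|ga| * (2 * N)) * N <= _).
    apply: ler_wpM2r; first exact: ltW.
    apply: le_trans (ler_normB _ _) _.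
    by rewrite lerD2l normrM ler_wpM2l // ger0_norm; lra.
  have : `|m1| * N <= 2 * (lam * k ^+ 2).
    apply: le_trans (_ : 2 * lam / s * N <= _); first by rewrite ler_wpM2r // ltW.
    have -> : 2 * lam / s * N = 2 * (lam * k) by rewrite NE; field; rewrite gt_eqF.
    by rewrite ler_pM2l // expr2 mulrA ler_peMr // mulr_ge0 //; lra.
  have -> : (`|m1| + `|ga| * (2 * N)) * N = `|m1| * N + 2 * (`|ga| * N ^+ 2) by ring.
  lra.
split=> //.
have -> : al = (al + be * x0 + ga * x0 ^+ 2) - be * x0 - ga * x0 ^+ 2 by ring.
have x0N : x0 <= N by lra.
have t1 : `|be * x0| <= 6 * (lam * k ^+ 2).
  rewrite normrM; apply: le_trans bE; rewrite ler_wpM2l // ger0_norm //.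
have t2 : `|ga * x0 ^+ 2| <= 2 * (lam * k ^+ 2).
  rewrite normrM; apply: le_trans gE'; rewrite ler_wpM2l // ger0_norm ?sqr_ge0 //.
  by rewrite lerXn2r ?nnegrE //; lra.
apply: le_trans (ler_normB _ _) _; apply: le_trans (lerD (ler_normB _ _) t2) _.
have : `|al + be * x0 + ga * x0 ^+ 2| <= lam by rewrite ler_norml; apply/andP; split; lra.
lra.
Qed.

Definition phase (h1 h2 h3 : R) (N a : nat) : R :=
  h1 * (a%:R / N%:R) + h2 * (a%:R / N%:R) ^+ 2 + h3 * (a%:R / N%:R) ^+ 3.

Lemma phase_opp h1 h2 h3 N a : phase (- h1) (- h2) (- h3) N a = - phase h1 h2 h3 N a.
Proof. by rewrite /phase; ring. Qed.

Lemma phaseB h1 h2 h3 N a : (0 < N)%N ->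
  phase h1 h2 h3 N a.+1 - phase h1 h2 h3 N a =
  (h1 / N%:R + h2 / N%:R ^+ 2 + h3 / N%:R ^+ 3)
  + (2 * h2 / N%:R ^+ 2 + 3 * h3 / N%:R ^+ 3) * a%:R
  + (3 * h3 / N%:R ^+ 3) * a%:R ^+ 2.
Proof.
move=> N0; rewrite /phase -natr1; field.
by rewrite pnatr_eq0 -lt0n.
Qed.

(** On [0, 1] the derivatives of x, x^2, x^3 are at most 1, 2, 3, so the increment is at most 6/100.
    This is the reason for restricting to frequencies below N/100. *)
Lemma norm_phaseB h1 h2 h3 N a : (a < N)%N ->
  `|h1| <= N%:R / 100 -> `|h2| <= N%:R / 100 -> `|h3| <= N%:R / 100 ->
  `|phase h1 h2 h3 N a.+1 - phase h1 h2 h3 N a| <= 1 / 2.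
Proof.
move=> aN b1 b2 b3.
have N0 : 0 < N%:R :> R by rewrite ltr0n; lia.
have aN' : a%:R + 1 <= N%:R :> R by rewrite natr1 ler_nat.
pose x : R := a%:R / N%:R; pose y : R := N%:R^-1.
have y0 : 0 < y by rewrite invr_gt0.
have x0 : 0 <= x by rewrite divr_ge0.
have xy1 : x + y <= 1.
  have -> : x + y = (a%:R + 1) / N%:R by rewrite /x /y mulrDl mul1r.
  by rewrite ler_pdivrMr ?mul1r.
have -> : phase h1 h2 h3 N a.+1 - phase h1 h2 h3 N a =
    (h1 * y) + (h2 * y) * (2 * x + y) + (h3 * y) * (3 * x ^+ 2 + 3 * x * y + y ^+ 2).
  by rewrite /phase -natr1 mulrDl -/x mul1r -/y; ring.
have c h : `|h| <= N%:R / 100 -> `|h * y| <= 1 / 100.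
  move=> hh; rewrite normrM (gtr0_norm y0) ler_pdivrMr //; lra.
have z2 : `|2 * x + y| <= 2 by rewrite ger0_norm; lra.
have z3 : `|3 * x ^+ 2 + 3 * x * y + y ^+ 2| <= 3.
  have xx : 0 <= x ^+ 2 by exact: sqr_ge0.
  have yy : 0 <= y ^+ 2 by exact: sqr_ge0.
  have xy0 : 0 <= x * y by rewrite mulr_ge0 // ltW.
  have : (x + y) ^+ 2 <= 1 by rewrite expr_le1 //; lra.
  rewrite sqrrD mulr2n => ?; rewrite ger0_norm; lra.
have t2 : `|h2 * y * (2 * x + y)| <= 1 / 100 * 2.
  by rewrite normrM; apply: ler_pM => //; apply: c.
have t3 : `|h3 * y * (3 * x ^+ 2 + 3 * x * y + y ^+ 2)| <= 1 / 100 * 3.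
  by rewrite normrM; apply: ler_pM => //; apply: c.
apply: le_trans (ler_normD _ _) _; apply: le_trans (lerD (ler_normD _ _) t3) _.
have := c _ b1; lra.
Qed.

(* Three [s]-separated points where the increment is below [1 / (15 s)] force
   all coefficients below [(N / s) ^ 3]; hence there are at most [2 s] points. *)
Lemma curve_exp_sum h1 h2 h3 N s : (0 < s <= N)%N ->
  `|h1| <= N%:R / 100 -> `|h2| <= N%:R / 100 -> `|h3| <= N%:R / 100 ->
  [|| (N%:R / s%:R) ^+ 3 <= `|h1|, (N%:R / s%:R) ^+ 3 <= `|h2| |
      (N%:R / s%:R) ^+ 3 <= `|h3| ] ->
  cmod (\sum_(0 <= a < N) e (phase h1 h2 h3 N a)) <= 302 * s%:R.
Proof.
move=> /andP[s0 sN] b1 b2 b3 big.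
have Nn : (0 < N)%N by lia.
have N0 : 0 < N%:R :> R by rewrite ltr0n.
have N1 : 1 <= N%:R :> R by rewrite ler1n; lia.
have s0' : 0 < s%:R :> R by rewrite ltr0n.
have sN' : s%:R <= N%:R :> R by rewrite ler_nat.
pose lam : R := (15 * s%:R)^-1.
have lam0 : 0 < lam by rewrite invr_gt0 mulr_gt0.
have main : cmod (\sum_(0 <= a < N) e (phase h1 h2 h3 N a)) <=
    small_count lam (phase h1 h2 h3 N) 0 N + 20 / lam.
  (* Negating the three coefficients conjugates the sum; a nonnegative [h3] makes the second
     differences of the phase nondecreasing. *)
  wlog h30 : h1 h2 h3 b1 b2 b3 big / 0 <= h3 => [hw|].
    have [/hw|/ltW h30] := lerP 0 h3; first exact.
    have := hw (- h1) (- h2) (- h3); rewrite !normrN oppr_ge0.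
    move=> /(_ b1 b2 b3 big h30).
    under eq_bigr do rewrite phase_opp.
    rewrite e_sum_conj -small_count_opp.
    congr (_ <= _ + _).
    by apply: eq_bigr => a _; rewrite !phase_opp opprK opprK.
  apply: e_sum_convex => // a => [aN|b ab]; first exact: norm_phaseB.
  rewrite !(phaseB _ _ _ _ Nn).
  have: a%:R <= b%:R :> R by rewrite ler_nat.
  rewrite -[a.+1%:R]natr1 -[b.+1%:R]natr1 => ab'; have q0 : 0 <= 3 * h3 / N%:R ^+ 3.
    by rewrite divr_ge0 ?mulr_ge0 // exprn_ge0 // ltW.
  move: (3 * h3 / _) q0 => q q0.
  have : 0 <= 2 * (q * (b%:R - a%:R)) by rewrite !mulr_ge0 // subr_ge0.
  move=> h; rewrite -subr_ge0; apply: le_trans h _; rewrite le_eqVlt.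
  by apply/orP; left; apply/eqP; ring.
apply: le_trans main _.
(* Two [s] small increments, plus 20/lam = 300 [s] from the Kusmin-Landau stretches. *)
have -> : 302 * s%:R = 2 * s%:R + 20 / lam by rewrite /lam invrK; ring.
rewrite lerD2r.
pose p a := `|phase h1 h2 h3 N a.+1 - phase h1 h2 h3 N a| < lam.
have -> : small_count lam (phase h1 h2 h3 N) 0 N = (count p (index_iota 0 N))%:R.
  rewrite /small_count -natr_sum -sum1_count; congr (_%:R).
  by rewrite [RHS]big_mkcond; apply: eq_bigr => a _; rewrite /p; case: ifP.
rewrite -natrM ler_nat leqNgt; apply/negP => /(three_spread_points s0).
move=> [a0 [a1 [a2 [[p0 p1 p2] [g01 g12 a2N]]]]].
move: p0 p1 p2; rewrite /p !(phaseB _ _ _ _ Nn).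
move=> p0 p1 p2.
have [] := quadratic_coef_bound lam0 _ _ _ _ _ p0 p1 p2 (N := N%:R) (s := s%:R).
- by rewrite s0'.
- by [].
- by rewrite ler_nat ltnW.
- by rewrite -natrD ler_nat.
- by rewrite -natrD ler_nat.
set k : R := N%:R / s%:R in big *.
have k1 : 1 <= k by rewrite ler_pdivlMr ?mul1r.
have -> : lam * k ^+ 2 = k ^+ 3 / 15 / N%:R.
  by rewrite /lam /k; field; rewrite !gt_eqF.
set n := N%:R : R; set K := k ^+ 3 in big *; have K0 : 0 < K by rewrite exprn_gt0 //; lra.
have n0 : n != 0 by rewrite gt_eqF.
move=> hg hb ha.
have e3 : `|h3| <= 2 / 45 * K.
  have E : h3 = (3 * h3 / n ^+ 3) * n ^+ 2 * (n / 3) by field.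
  rewrite E normrM normrM (ger0_norm (sqr_ge0 n)) (ger0_norm (_ : 0 <= n / 3)); last by lra.
  have -> : 2 / 45 * K = 2 * (K / 15 / n) * (n / 3) by field.
  by rewrite ler_wpM2r //; lra.
have e2 : `|h2| <= 4 / 15 * K.
  have E : h2 = ((2 * h2 / n ^+ 2 + 3 * h3 / n ^+ 3) * n) * (n / 2) - 3 / 2 * h3 / n.
    by field.
  rewrite E; apply: le_trans (ler_normB _ _) _.
  have f1 : `|3 / 2 * h3 / n| <= 3 / 2 * `|h3|.
    rewrite -mulrA normrM.
    have -> : `|3 / 2| = 3 / 2 :> R by apply: ger0_norm; lra.
    apply: ler_wpM2l; first by lra.
    by rewrite normrM ler_piMr // normfV (ger0_norm (ltW N0)) invf_le1.
  have f2 : `|(2 * h2 / n ^+ 2 + 3 * h3 / n ^+ 3) * n * (n / 2)| <= 6 / 30 * K.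
    rewrite normrM normrM (gtr0_norm N0) (ger0_norm (_ : 0 <= n / 2)); last by lra.
    have -> : 6 / 30 * K = 6 * (K / 15 / n) * (n / 2) by field.
    by rewrite ler_wpM2r //; lra.
  lra.
(* The contributions 9/15, 4/15 and 2/45 add up to 41/45, so the factor 15 in [lam] is large enough
   to contradict [big]. *)
have e1 : `|h1| < K.
  have E : h1 = ((h1 / n + h2 / n ^+ 2 + h3 / n ^+ 3)) * n - h2 / n - h3 / n / n.
    by field.
  have inv1 : `|n^-1| <= 1 by rewrite normfV (ger0_norm (ltW N0)) invf_le1.
  rewrite E; apply: le_lt_trans (ler_normB _ _) _.
  have f1 : `|h2 / n| <= `|h2| by rewrite normrM ler_piMr.
  have f3 : `|h3 / n / n| <= `|h3|.
    by rewrite normrM; apply: le_trans (_ : `|h3 / n| <= _); rewrite ?normrM ler_piMr.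
  have f2 : `|(h1 / n + h2 / n ^+ 2 + h3 / n ^+ 3) * n| <= 9 / 15 * K.
    rewrite normrM (gtr0_norm N0).
    have -> : 9 / 15 * K = 9 * (K / 15 / n) * n by field.
    by rewrite ler_wpM2r //; lra.
  apply: le_lt_trans (lerD (ler_normB _ _) f3) _.
  lra.
case/or3P: big; lra.
Qed.

End Curve.

(** * Exponential sums over digits *)

Lemma sum_nat_mul (V : zmodType) (F : nat -> V) a b :
  \sum_(0 <= k < a * b) F k = \sum_(0 <= i < a) \sum_(0 <= j < b) F (i + j * a)%N.
Proof.
elim: b => [|b IH].
  by rewrite muln0 big_geq // big1 // => i _; rewrite big_geq.
rewrite mulnS addnC (big_cat_nat _ _ (n := (a * b)%N)) ?leq_addr //= IH.
rewrite -{1}[(a * b)%N]add0n big_addn addKn -big_split /=.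
by apply: eq_bigr => i _; rewrite big_nat_recr //= [(b * a)%N]mulnC.
Qed.

Section DigitSums.
Variable R : realType.

(** Each dyadic block from 2^i to 2^(i+1) contributes at most 1; the index 0 contributes nothing
    because [0^-1] is 0. *)
Lemma harmonic_bound r : \sum_(0 <= j < 2 ^ r) (j%:R^-1 : R) <= r%:R.
Proof.
elim: r => [|r IH]; first by rewrite big_nat1 invr0.
rewrite (big_cat_nat _ _ (n := (2 ^ r)%N)) //=; last by rewrite leq_exp2l.
rewrite -natr1 lerD //.
have p0 : 0 < (2 ^ r)%:R :> R by rewrite ltr0n expn_gt0.
apply: le_trans (_ : \sum_(2 ^ r <= j < 2 ^ r.+1) ((2 ^ r)%:R^-1 : R) <= _).
  rewrite big_nat [leRHS]big_nat; apply: ler_sum => j /andP[h _].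
  have h' : (2 ^ r)%:R <= j%:R :> R by rewrite ler_nat.
  by rewrite lef_pV2 ?posrE // (lt_le_trans p0).
rewrite sumr_const_nat expnS mul2n -addnn addnK.
by rewrite -[_ *+ _]mulr_natr mulVf // gt_eqF.
Qed.

Variables (B M : nat).

Definition digit_sum (x : R) : R[i] := \sum_(d < M) e (d%:R * x).

Lemma cmod_digit_sum_le x : cmod (digit_sum x) <= M%:R.
Proof.
apply: le_trans (cmod_sum _ _ _) _; under eq_bigr do rewrite cmod_e.
by rewrite sumr_const card_ord.
Qed.

Lemma digit_sumDn x k : digit_sum (x + k%:R) = digit_sum x.
Proof. by apply: eq_bigr => d _; rewrite mulrDr -natrM eD e_nat mulr1. Qed.

Lemma digit_sumN x : cmod (digit_sum (- x)) = cmod (digit_sum x).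
Proof.
rewrite -[RHS]cmod_conj rmorph_sum /=; congr cmod.
by apply: eq_bigr => d _; rewrite mulrN -e_conj.
Qed.

Lemma digit_sum_le_inv x y : `|x| <= 1 / 2 -> 0 < y -> y <= `|x| ->
  cmod (digit_sum x) <= y^-1.
Proof.
move=> x2 y0 yx; have h := e_lower x2; have g := cmod_geometric x M.
rewrite -[leRHS]mul1r ler_pdivlMr // -(ler_pM2r (_ : 0 < 2 :> R)) //.
apply: le_trans (le_trans _ g) _; last by lra.
rewrite -mulrA ler_wpM2l ?cmod_ge0 //; lra.
Qed.

Hypothesis B1 : (1 < B)%N.

(** The point lies between j/B and (j+1)/B, so its distance to the nearest integer is at least j/B
    or at least (B-1-j)/B, and the geometric series gives the inverse. Only the two extreme [j] need
    the trivial bound [M]; there one of the inverses is the conventional [0^-1 = 0]. *)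
Lemma digit_sum_shift_le th j : 0 <= th -> th <= B%:R^-1 -> (j < B)%N ->
  cmod (digit_sum (th + j%:R / B%:R)) <=
  (j == 0%N)%:R * M%:R + (j == B.-1)%:R * M%:R
  + (B%:R * j%:R^-1 + B%:R * (B.-1 - j)%:R^-1).
Proof.
move=> th0 thB jB.
have BE : (B.-1 - j + j).+1 = B by lia.
have Bp : 0 < B%:R :> R by rewrite ltr0n; lia.
have i0 k : 0 <= B%:R * k%:R^-1 :> R by rewrite mulr_ge0 ?invr_ge0.
have tr := cmod_digit_sum_le (th + j%:R / B%:R).
have M0 : 0 <= M%:R :> R by [].
have a0 := i0 j; have a1 := i0 (B.-1 - j)%N.
have [->|jn0] := eqVneq j 0%N.
  rewrite mul1r; have : 0 <= (0%N == B.-1)%:R * M%:R :> R by rewrite mulr_ge0.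
  have := i0 0%N; have := i0 (B.-1 - 0)%N; have := cmod_digit_sum_le (th + 0%:R / B%:R); lra.
have [jE|jnB] := eqVneq j B.-1; first by rewrite mul0r mul1r; lra.
rewrite !mul0r !add0r.
have j0 : 0 < j%:R :> R by rewrite ltr0n lt0n.
have k0 : 0 < (B.-1 - j)%:R :> R by rewrite ltr0n; lia.
set x := th + j%:R / B%:R.
have xlo : j%:R / B%:R <= x by rewrite /x lerDr.
have x0 : 0 < x by apply: lt_le_trans xlo; rewrite divr_gt0.
have xhi : x <= 1 - (B.-1 - j)%:R / B%:R.
  have -> : 1 - (B.-1 - j)%:R / B%:R = B%:R^-1 + j%:R / B%:R :> R.
    have -> : B%:R = (B.-1 - j)%:R + j%:R + 1 :> R.
      by rewrite -natrD natr1 BE.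
    by field; rewrite gt_eqF //; lra.
  by rewrite /x lerD2r.
have c1 : 0 < (B.-1 - j)%:R / B%:R :> R by rewrite divr_gt0.
have [xs|xb] := lerP x (1 / 2).
  apply: le_trans (_ : (j%:R / B%:R)^-1 <= _).
    by apply: digit_sum_le_inv; rewrite ?(gtr0_norm x0) // divr_gt0.
  by rewrite invfM invrK mulrC; lra.
have -> : digit_sum x = digit_sum (x - 1).
  by rewrite -[in LHS](subrK 1 x) -[1 in X in _ + X]/(1%:R) digit_sumDn.
apply: le_trans (_ : ((B.-1 - j)%:R / B%:R)^-1 <= _).
  have E : `|x - 1| = 1 - x by rewrite ler0_norm; lra.
  by apply: digit_sum_le_inv; rewrite ?divr_gt0 // E; lra.
by rewrite invfM invrK mulrC; lra.
Qed.

Variable (W : R).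
Hypothesis hW : 2 * M%:R + 2 * B%:R * \sum_(0 <= j < B) j%:R^-1 <= W.

Lemma digit_sum_l1 th : 0 <= th -> th <= B%:R^-1 ->
  \sum_(0 <= j < B) cmod (digit_sum (th + j%:R / B%:R)) <= W.
Proof.
move=> th0 thB; apply: le_trans hW.
apply: le_trans (_ : \sum_(0 <= j < B) ((j == 0%N)%:R * M%:R + (j == B.-1)%:R * M%:R
  + (B%:R * j%:R^-1 + B%:R * (B.-1 - j)%:R^-1)) <= _).
  rewrite big_nat [leRHS]big_nat; apply: ler_sum => j /andP[_ jB].
  exact: digit_sum_shift_le.
have sing c : (c < B)%N -> \sum_(0 <= j < B) (j == c)%:R * M%:R = M%:R :> R.
  move=> cB; rewrite (bigD1_seq c) ?mem_index_iota ?iota_uniq //= eqxx mul1r.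
  by rewrite big1 ?addr0 // => j /negbTE ->; rewrite mul0r.
rewrite !big_split /= !sing; try lia.
rewrite -!mulr_sumr.
have -> : \sum_(0 <= i < B) (B.-1 - i)%:R^-1 = \sum_(0 <= i < B) i%:R^-1 :> R.
  rewrite [RHS]big_nat_rev /= add0n; apply: eq_bigr => i _.
  by congr (_%:R^-1); lia.
by lra.
Qed.

(* The modulus at frequency [k] of the exponential sum over the points with [n]
   digits below [M], see [cmod_weight]. *)
Definition kappa n k : R := \prod_(r < n) cmod (digit_sum (k%:R / B%:R ^+ r.+1)).

Lemma kappa_ge0 n k : 0 <= kappa n k.
Proof. by apply: prodr_ge0 => r _; exact: cmod_ge0. Qed.

Lemma W_ge0 : 0 <= W.
Proof.
apply: le_trans hW; rewrite addr_ge0 ?mulr_ge0 //.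
by apply: sumr_ge0 => j _; rewrite invr_ge0.
Qed.

(** Write k = i + j B^m. By periodicity the first [m] factors depend on [i] only, and the last one
    is taken at i/B^(m+1) + j/B with i/B^(m+1) at most 1/B, so its sum over [j] is at most [W]. Each
    level thus costs one factor [W]. *)
Lemma kappa_sum m : \sum_(0 <= k < B ^ m) kappa m k <= W ^+ m.
Proof.
have Bp : 0 < B%:R :> R by rewrite ltr0n; lia.
elim: m => [|m IH]; first by rewrite big_nat1 /kappa big_ord0.
rewrite expnSr sum_nat_mul.
apply: le_trans (_ : \sum_(0 <= i < B ^ m) kappa m i * W <= _); last first.
  by rewrite -mulr_suml exprSr ler_wpM2r // W_ge0.
rewrite big_nat [leRHS]big_nat; apply: ler_sum => i /andP[_ iB].
have E j : kappa m.+1 (i + j * B ^ m) =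
    kappa m i * cmod (digit_sum (i%:R / B%:R ^+ m.+1 + j%:R / B%:R)).
  rewrite /kappa big_ord_recr /=; congr (_ * cmod (digit_sum _)).
    apply: eq_bigr => r _; congr cmod.
    have -> : (i + j * B ^ m)%:R / B%:R ^+ r.+1 =
        i%:R / B%:R ^+ r.+1 + (j * B ^ (m - r.+1))%:R :> R.
      rewrite natrD mulrDl !natrM !natrX -mulrA; congr (_ + _ * _).
      have rm : (r < m)%N := ltn_ord r.
      have -> : B%:R ^+ m = B%:R ^+ (m - r.+1) * B%:R ^+ r.+1 :> R.
        by rewrite -exprD subnK.
      by rewrite mulfK // expf_neq0 // gt_eqF.
    exact: digit_sumDn.
  rewrite natrD natrM natrX exprS; field.
  by rewrite gt_eqF //= expf_neq0 // gt_eqF.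
under eq_bigr do rewrite E.
rewrite -mulr_sumr ler_wpM2l ?kappa_ge0 //; apply: digit_sum_l1.
  by rewrite divr_ge0 // exprn_ge0.
rewrite exprSr invfM mulrA ler_piMl ?invr_ge0 //.
rewrite ler_pdivrMr ?exprn_gt0 // mul1r -natrX ler_nat; exact: ltnW.
Qed.

Lemma kappaD_le m l k : kappa (m + l) k <= kappa m k * M%:R ^+ l.
Proof.
rewrite /kappa big_split_ord /=.
apply: ler_wpM2l; first by apply: prodr_ge0 => r _; exact: cmod_ge0.
rewrite -[in leRHS](card_ord l) -prodr_const; apply: ler_prod => r _.
by rewrite cmod_ge0 cmod_digit_sum_le.
Qed.

(** Frequencies below B^m are averaged through the first [m] factors only; the other [n - m] are
    bounded by [M], which is sharp at frequency 0. *)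
Lemma kappa_sum_le n m : (m <= n)%N ->
  \sum_(0 <= k < B ^ m) kappa n k <= W ^+ m * M%:R ^+ (n - m).
Proof.
move=> mn; apply: le_trans (_ : \sum_(0 <= k < B ^ m) kappa m k * M%:R ^+ (n - m) <= _).
  by apply: ler_sum => k _; rewrite -{1}(subnKC mn) kappaD_le.
by rewrite -mulr_suml ler_wpM2r ?exprn_ge0 // kappa_sum.
Qed.

End DigitSums.

(** * Fejer kernels and the counting bound *)

Lemma big_distr3 (K : pzRingType) (I : finType) (F G H : I -> K) :
  (\sum_i F i) * (\sum_i G i) * (\sum_i H i) =
  \sum_i \sum_j \sum_k F i * G j * H k.
Proof.
rewrite big_distrlr /= mulr_suml; apply: eq_bigr => i _.
by rewrite mulr_suml; apply: eq_bigr => j _; rewrite mulr_sumr.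
Qed.

(** The absolute difference of the two indices: one of the truncated subtractions is always 0. *)
Definition pdist (D : nat) (p : 'I_D * 'I_D) : nat := (p.1 - p.2 + (p.2 - p.1))%N.

(** For a fixed [i], each distance is attained by at most two indices [j], one on either side. *)
Lemma sum_dist_le (R : realType) (F : nat -> R) (D i : nat) : (forall k, 0 <= F k) ->
  (i < D)%N ->
  \sum_(0 <= j < D) F (i - j + (j - i))%N <= 2 * \sum_(0 <= k < D) F k.
Proof.
move=> F0 iD.
have le_sum a : (a <= D)%N -> \sum_(0 <= k < a) F k <= \sum_(0 <= k < D) F k.
  move=> aD; rewrite [leRHS](big_cat_nat _ _ (n := a)) //= lerDl.
  exact: sumr_ge0.
rewrite (big_cat_nat _ _ (n := i.+1)) //= [leRHS]mulr_natl mulr2n lerD //.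
  apply: le_trans (le_sum i.+1 iD); rewrite le_eqVlt; apply/orP; left; apply/eqP.
  rewrite big_nat_rev /= !big_nat; apply: eq_bigr => k /andP[_ ki].
  by congr F; lia.
apply: le_trans (le_sum (D - i)%N (leq_subr _ _)).
rewrite -{1}[i.+1]add0n big_addn.
rewrite [leRHS](_ : _ = F 0%N + \sum_(0 <= k < D - i.+1) F k.+1); last first.
  by rewrite -big_nat_recl // -subSn.
rewrite -[leLHS]add0r lerD // le_eqVlt; apply/orP; left; apply/eqP.
by apply: eq_bigr => k _; congr F; lia.
Qed.

Lemma sum_pdist (R : realType) (F : nat -> R) (D : nat) : (forall k, 0 <= F k) ->
  \sum_(p : 'I_D * 'I_D) F (pdist p) <= 2 * D%:R * \sum_(0 <= k < D) F k.
Proof.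
move=> F0; rewrite -(pair_bigA _ (fun i j : 'I_D => F (i - j + (j - i))%N)) /=.
apply: le_trans (_ : \sum_(i < D) 2 * \sum_(0 <= k < D) F k <= _).
  apply: ler_sum => i _; have := sum_dist_le F0 (ltn_ord i).
  by rewrite (big_mkord xpredT (fun j => F (i - j + (j - i))%N)).
by rewrite sumr_const card_ord -[_ *+ D]mulr_natl mulrA [D%:R * 2]mulrC.
Qed.

Section Fejer.
Variables (R : realType) (B M n D : nat).
Local Notation digits := {ffun 'I_n -> 'I_M}.

Definition digit_point (f : digits) : R := \sum_(r < n) (f r)%:R / B%:R ^+ r.+1.

(** Each summand is [D] times a Fejer kernel centred at a digit point. As a square it is nonnegative
    everywhere, so it may be summed over all grid points and not only over those that are
    counted. *)
Definition fejer (x : R) : R :=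
  \sum_(f : digits) cmod (\sum_(j < D) e (j%:R * (x - digit_point f))) ^+ 2.

Definition pdiff (p : 'I_D * 'I_D) : R := p.1%:R - p.2%:R.

(* The coefficient of [e (pdiff p * x)] in the Fourier expansion of [fejer x]:
   frequencies are indexed by pairs of exponents below [D]. *)
Definition weight (p : 'I_D * 'I_D) : R[i] :=
  \sum_(f : digits) e (pdiff p * - digit_point f).

Lemma fejer_ge0 x : 0 <= fejer x.
Proof. by apply: sumr_ge0 => f _; rewrite sqr_ge0. Qed.

Lemma fejerE x : (fejer x)%:C%C = \sum_p e (pdiff p * x) * weight p.
Proof.
rewrite /fejer rmorph_sum /=.
under [RHS]eq_bigr do rewrite mulr_sumr.
rewrite exchange_big /=; apply: eq_bigr => f _.
rewrite -mulC_conj rmorph_sum /= big_distrlr /= pair_bigA /=.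
apply: eq_bigr => p _; rewrite -eD.
transitivity (e (p.1%:R * (x - digit_point f)) * e (- (p.2%:R * (x - digit_point f)))).
  by rewrite -e_conj.
by rewrite -eD; congr e; rewrite /pdiff; ring.
Qed.

Lemma norm_pdiff p : `|pdiff p| = (pdist p)%:R.
Proof.
rewrite /pdiff /pdist; case: (leqP p.1 p.2) => h.
  have -> : (p.1 - p.2 = 0)%N by lia.
  by rewrite add0n natrB // distrC ger0_norm // subr_ge0 ler_nat.
have -> : (p.2 - p.1 = 0)%N by lia.
by rewrite addn0 natrB ?ger0_norm ?subr_ge0 ?ler_nat // ltnW.
Qed.

(** The digits of a digit point are independent, so the exponential sum over all of them factors
    into one digit sum per position. *)
Lemma cmod_weight p : cmod (weight p) = kappa R B M n (pdist p).
Proof.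
have -> : weight p = \prod_(r < n) digit_sum M (- (pdiff p / B%:R ^+ r.+1)).
  rewrite /digit_sum bigA_distr_bigA /=; apply: eq_bigr => f _.
  rewrite mulrN mulr_sumr -sumrN e_sum; apply: eq_bigr => r _.
  by congr e; ring.
rewrite cmod_prod; apply: eq_bigr => r _; rewrite digit_sumN -norm_pdiff.
case: (ger0P (pdiff p)) => // _.
by rewrite mulNr digit_sumN.
Qed.

(** Close to a digit point every exponential in its kernel is within 8/24 = 1/3 of 1, so the inner
    sum has modulus at least D/2; the other kernels only add. *)
Lemma fejer_lower x f : `|x - digit_point f| * D%:R <= 1 / 24 ->
  D%:R ^+ 2 / 4 <= fejer x.
Proof.
move=> hx; rewrite /fejer (bigD1 f) //=.
apply: ler_wpDr; first by apply: sumr_ge0 => g _; rewrite sqr_ge0.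
set y := x - _ in hx *.
suff h : D%:R / 2 <= cmod (\sum_(j < D) e (j%:R * y)).
  have -> : D%:R ^+ 2 / 4 = (D%:R / 2) ^+ 2 :> R by field.
  by rewrite lerXn2r ?nnegrE ?cmod_ge0 // divr_ge0.
have h1 : cmod (\sum_(j < D) (1 - e (j%:R * y))) <= D%:R * (1 / 2).
  apply: le_trans (cmod_sum _ _ _) _.
  apply: le_trans (_ : \sum_(j < D) (1 / 2 : R) <= _).
    apply: ler_sum => j _; rewrite cmodB; apply: le_trans (e_lip _) _.
    have jD : j%:R <= D%:R :> R by rewrite ler_nat ltnW.
    rewrite normrM (ger0_norm (ler0n _ _)).
    have : j%:R * `|y| <= `|y| * D%:R by rewrite mulrC ler_wpM2l.
    by lra.
  by rewrite sumr_const card_ord -[_ *+ D]mulr_natl.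
have := cmodD (\sum_(j < D) (1 - e (j%:R * y))) (\sum_(j < D) e (j%:R * y)).
rewrite -big_split /=; under eq_bigr do rewrite subrK.
rewrite sumr_const card_ord.
have -> : cmod (1 *+ D) = D%:R :> R.
  have -> : (1 *+ D : R[i]) = (D%:R : R)%:C%C by rewrite rmorph_nat.
  by rewrite /cmod /= expr0n addr0 sqrtr_sqr ger0_norm.
lra.
Qed.

Lemma fejer_product_sum N :
  \sum_(0 <= a < N) fejer (a%:R / N%:R) * fejer ((a%:R / N%:R) ^+ 2)
                    * fejer ((a%:R / N%:R) ^+ 3) <=
  \sum_p \sum_q \sum_s kappa R B M n (pdist p) * kappa R B M n (pdist q)
     * kappa R B M n (pdist s)
     * cmod (\sum_(0 <= a < N) e (phase (pdiff p) (pdiff q) (pdiff s) N a)).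
Proof.
set L := (X in X <= _).
have L0 : 0 <= L by apply: sumr_ge0 => a _; rewrite !mulr_ge0 ?fejer_ge0.
have -> : L = cmod (L%:C%C) by rewrite /cmod /= expr0n addr0 sqrtr_sqr ger0_norm.
have -> : L%:C%C = \sum_p \sum_q \sum_s weight p * weight q * weight s *
    \sum_(0 <= a < N) e (phase (pdiff p) (pdiff q) (pdiff s) N a).
  rewrite /L rmorph_sum /=.
  under eq_bigr do rewrite !rmorphM /= !fejerE big_distr3.
  rewrite exchange_big; apply: eq_bigr => p _.
  rewrite exchange_big; apply: eq_bigr => q _.
  rewrite exchange_big; apply: eq_bigr => s _.
  rewrite mulr_sumr; apply: eq_bigr => a _.
  by rewrite /phase !eD; ring.
do 3! (apply: le_trans (cmod_sum _ _ _) _; apply: ler_sum => ? _).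
by rewrite !cmodM !cmod_weight.
Qed.

End Fejer.

(** * Counting the grid points whose first three powers are near digit points *)

Section Counting.
Variables (R : realType) (P M n D : nat) (W : R).
Local Notation B := (P ^ 3)%N.
Local Notation N := (B ^ n)%N.
Hypothesis P1 : (1 < P)%N.
Hypothesis ND : N = (100 * D)%N.
Hypothesis hW : 2 * M%:R + 2 * B%:R * \sum_(0 <= j < B) j%:R^-1 <= W.
Hypothesis hWM : 2 * W ^+ 3 <= M%:R ^+ 3 * P%:R.

(** Bound for the exponential sum when the largest frequency lies between B^(m-1) and B^m: as B =
    P^3, its cube root is at least P^(m-1), which accounts for the extra factor [P]. For m = 0 the
    value exceeds the trivial bound [N]. *)
Let tau m : R := 302 * N%:R * P%:R / P%:R ^+ m.
Let small m (p : 'I_D * 'I_D) : R := ((pdist p < B ^ m)%N)%:R.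

Let P0 : 0 < P%:R :> R. Proof. by rewrite ltr0n; lia. Qed.

Let tau_ge0 m : 0 <= tau m.
Proof.
apply: divr_ge0; last exact: exprn_ge0.
by do 2 (apply: mulr_ge0; last exact: ler0n); exact: ler0n.
Qed.

(** Only the term of the least [m] with all three frequencies below B^m is used; the others are
    nonnegative. The sum over [m] is introduced because each of its terms factors over [p], [q],
    [s]. *)
Lemma phase_sum_bound p q s :
  cmod (\sum_(0 <= a < N) e (phase (pdiff R p) (pdiff R q) (pdiff R s) N a)) <=
  \sum_(m < n.+1) tau m * (small m p * small m q * small m s).
Proof.
have p0 := P0.
have Np : (0 < N)%N by rewrite !expn_gt0; lia.
pose ok m := [&& pdist p < B ^ m, pdist q < B ^ m & pdist s < B ^ m]%N.
have dD (t : 'I_D * 'I_D) : (pdist t < D)%N.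
  by rewrite /pdist; have := ltn_ord t.1; have := ltn_ord t.2; lia.
have DN : (D <= N)%N by lia.
have okn : ok n by rewrite /ok !(leq_trans (dD _) DN).
have exok : exists m, ok m by exists n.
case: (ex_minnP exok) => m okm mmin.
have mn : (m < n.+1)%N by rewrite ltnS mmin.
rewrite (bigD1 (Ordinal mn)) //=.
apply: ler_wpDr.
  by apply: sumr_ge0 => i _; rewrite !mulr_ge0 ?tau_ge0 ?ler0n.
have -> : small m p * small m q * small m s = 1.
  by rewrite /small; move: okm => /and3P[-> -> ->]; rewrite !mulr1.
rewrite mulr1; case: m okm mmin mn => [|m] okm mmin mn.
  apply: le_trans (cmod_sum _ _ _) _; under eq_bigr do rewrite cmod_e.
  rewrite sumr_const_nat subn0 /tau expr0 divr1.
  have : 1 <= P%:R :> R by rewrite ler1n; lia.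
  have : 0 <= N%:R :> R by [].
  move=> N0 P1'; rewrite -mulrA; have : N%:R <= N%:R * P%:R :> R by rewrite ler_peMr.
  lra.
have nokm : ~~ ok m by apply/negP => /mmin; rewrite ltnn.
pose t := (P ^ (3 * n - m))%N.
have NE : N = (t * P ^ m)%N by rewrite -expnM /t -expnD subnK //; lia.
have t0 : (0 < t)%N by rewrite expn_gt0; lia.
have tN : (t <= N)%N by rewrite NE leq_pmulr // expn_gt0; lia.
have quo : N%:R / t%:R = P%:R ^+ m :> R.
  by rewrite NE natrM natrX [t%:R * _]mulrC mulfK // pnatr_eq0 -lt0n.
have bd (u : 'I_D * 'I_D) : `|pdiff R u| <= N%:R / 100.
  have -> : N%:R / 100 = D%:R :> R by rewrite ND natrM; field.
  by rewrite norm_pdiff ler_nat ltnW.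
have -> : tau m.+1 = 302 * t%:R.
  rewrite /tau exprS NE natrM natrX; field.
  by rewrite ?expf_neq0 // gt_eqF.
apply: curve_exp_sum => //; first by rewrite t0.
rewrite quo -exprM mulnC exprM !norm_pdiff -!natrX !ler_nat.
by move: nokm; rewrite /ok !negb_and -!leqNgt.
Qed.

Let kap := kappa R B M n.

Lemma small_kappa_sum m : (m <= n)%N ->
  \sum_p kap (pdist p) * small m p <= 2 * D%:R * (W ^+ m * M%:R ^+ (n - m)).
Proof.
move=> mn.
have F0 k : 0 <= kap k * ((k < B ^ m)%N)%:R by rewrite mulr_ge0 ?kappa_ge0.
apply: le_trans (sum_pdist D F0) _; rewrite ler_wpM2l ?mulr_ge0 //.
apply: le_trans (_ : \sum_(0 <= k < N) kap k * ((k < B ^ m)%N)%:R <= _).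
  rewrite [leRHS](big_cat_nat _ _ (n := D)) //=; last by lia.
  by rewrite lerDl; apply: sumr_ge0.
have Bm : (B ^ m <= N)%N by rewrite leq_pexp2l // expn_gt0; lia.
rewrite (big_cat_nat _ _ (n := (B ^ m)%N)) //=.
rewrite [X in _ + X]big_nat_cond [X in _ + X]big1 ?addr0; last first.
  by move=> k /andP[/andP[h _] _]; rewrite ltnNge h mulr0.
apply: le_trans (kappa_sum_le _ hW mn); last by rewrite -{1}[1%N](exp1n 3) ltn_exp2r.
rewrite big_nat [leRHS]big_nat; apply: ler_sum => k /andP[_ ->].
by rewrite mulr1.
Qed.

Lemma geometric_half k : \sum_(m < k) (1 / 2 : R) ^+ m <= 2.
Proof.
have -> : \sum_(m < k) (1 / 2 : R) ^+ m = 2 - 2 * (1 / 2) ^+ k.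
  elim: k => [|k IH]; first by rewrite big_ord0 expr0; ring.
  by rewrite big_ord_recr /= IH exprS; field.
have : 0 <= (1 / 2 : R) ^+ k by rewrite exprn_ge0.
lra.
Qed.

(** Every counted point contributes at least (D^2/4)^3 to the sum of the products of three kernels.
    In Fourier space the bound for level [m] is the one for level 0, the zero frequency, times at
    most 2^(-m), so the whole sum is at most twice the bound at level 0. *)
Lemma digit_curve_count (p : pred nat) :
  (forall a, (a < N)%N -> p a -> exists f1 f2 f3 : {ffun 'I_n -> 'I_M},
     [/\ `|a%:R / N%:R - digit_point R B f1| * D%:R <= 1 / 24,
         `|(a%:R / N%:R) ^+ 2 - digit_point R B f2| * D%:R <= 1 / 24 &
         `|(a%:R / N%:R) ^+ 3 - digit_point R B f3| * D%:R <= 1 / 24]) ->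
  (count p (index_iota 0 N))%:R * D%:R ^+ 3 <= (302 * 16 * 64) * (N%:R * P%:R * M%:R ^+ (3 * n)) :> R.
Proof.
move=> hp; have p0 := P0.
have Np : (0 < N)%N by rewrite !expn_gt0; lia.
have D0 : 0 < D%:R :> R by rewrite ltr0n; lia.
have lo : (count p (index_iota 0 N))%:R * (D%:R ^+ 2 / 4) ^+ 3 <=
  \sum_(0 <= a < N) fejer B M n D (a%:R / N%:R) * fejer B M n D ((a%:R / N%:R) ^+ 2)
     * fejer B M n D ((a%:R / N%:R) ^+ 3) :> R.
  have -> : (count p (index_iota 0 N))%:R = \sum_(0 <= a < N | p a) 1 :> R.
    by rewrite -sum1_count natr_sum.
  rewrite mulr_suml big_mkcond big_nat [leRHS]big_nat.
  apply: ler_sum => a /andP[_ aN]; case: ifP => [pa|_]; last first.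
    by rewrite !mulr_ge0 ?fejer_ge0.
  have [f1 [f2 [f3 [g1 g2 g3]]]] := hp a aN pa.
  have z : 0 <= D%:R ^+ 2 / 4 :> R by rewrite divr_ge0 ?exprn_ge0.
  rewrite mul1r exprS mulrA expr2.
  apply: ler_pM; rewrite ?mulr_ge0 //; last exact: fejer_lower g3.
  by apply: ler_pM => //; [exact: fejer_lower g1 | exact: fejer_lower g2].
have hi : \sum_(0 <= a < N) fejer B M n D (a%:R / N%:R) * fejer B M n D ((a%:R / N%:R) ^+ 2)
     * fejer B M n D ((a%:R / N%:R : R) ^+ 3) <=
   \sum_(m < n.+1) tau m * (\sum_p kap (pdist p) * small m p) ^+ 3.
  apply: le_trans (fejer_product_sum R B M n D N) _.
  have -> : \sum_(m < n.+1) tau m * (\sum_p kap (pdist p) * small m p) ^+ 3 =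
    \sum_p \sum_q \sum_s kap (pdist p) * kap (pdist q) * kap (pdist s) *
     \sum_(m < n.+1) tau m * (small m p * small m q * small m s).
    under eq_bigr do rewrite exprSr expr2 big_distr3 mulr_sumr.
    rewrite exchange_big; apply: eq_bigr => x _.
    under eq_bigr do rewrite mulr_sumr.
    rewrite exchange_big; apply: eq_bigr => y _.
    under eq_bigr do rewrite mulr_sumr.
    rewrite exchange_big; apply: eq_bigr => z _.
    by rewrite mulr_sumr; apply: eq_bigr => m _; ring.
  do 3! (apply: ler_sum => ? _).
  by rewrite ler_wpM2l ?phase_sum_bound // !mulr_ge0 ?kappa_ge0.
have W0 : 0 <= W by apply: W_ge0 hW.
have tot : \sum_(m < n.+1) tau m * (\sum_p kap (pdist p) * small m p) ^+ 3 <=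
    (302 * 16) * (N%:R * P%:R * M%:R ^+ (3 * n)) * D%:R ^+ 3.
  (* Going up one level multiplies the bound by W^3 / (M^3 P), which is at most 1/2 by [hWM]. *)
  apply: le_trans (_ : \sum_(m < n.+1)
     ((302 * 8) * (N%:R * P%:R * M%:R ^+ (3 * n)) * D%:R ^+ 3) * (1 / 2) ^+ m <= _).
    apply: ler_sum => m _; have mn : (m <= n)%N by rewrite -ltnS ltn_ord.
    have S0 : 0 <= \sum_p kap (pdist p) * small m p.
      by apply: sumr_ge0 => x _; rewrite mulr_ge0 ?kappa_ge0.
    apply: le_trans (_ : tau m * (2 * D%:R * (W ^+ m * M%:R ^+ (n - m))) ^+ 3 <= _).
      rewrite ler_wpM2l ?tau_ge0 // lerXn2r ?nnegrE ?small_kappa_sum //.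
      by rewrite !mulr_ge0 ?exprn_ge0.
    have -> : tau m * (2 * D%:R * (W ^+ m * M%:R ^+ (n - m))) ^+ 3 =
       ((302 * 8) * (N%:R * P%:R) * D%:R ^+ 3 / P%:R ^+ m * (1 / 2) ^+ m) *
        ((2 * W ^+ 3) ^+ m * M%:R ^+ (3 * (n - m))).
      rewrite /tau [(2 * W ^+ 3) ^+ m]exprMn -[(W ^+ 3) ^+ m]exprM [(3 * m)%N]mulnC.
      rewrite [W ^+ (m * 3)]exprM [M%:R ^+ (3 * (n - m))](exprM _ 3) mulrC.
      rewrite -[(M%:R ^+ 3) ^+ (n - m)]exprM [(3 * (n - m))%N]mulnC [M%:R ^+ (_ * 3)]exprM.
      have h2 : (1 / 2) ^+ m * 2 ^+ m = 1 :> R by rewrite -exprMn mul1r mulVf ?expr1n.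
      transitivity ((302 * 8) * (N%:R * P%:R) * D%:R ^+ 3 / P%:R ^+ m * ((1 / 2) ^+ m * 2 ^+ m)
         * (W ^+ m) ^+ 3 * (M%:R ^+ (n - m)) ^+ 3); last by ring.
      rewrite h2; ring.
    have -> : (302 * 8) * (N%:R * P%:R * M%:R ^+ (3 * n)) * D%:R ^+ 3 * (1 / 2) ^+ m =
       ((302 * 8) * (N%:R * P%:R) * D%:R ^+ 3 / P%:R ^+ m * (1 / 2) ^+ m) *
        ((M%:R ^+ 3 * P%:R) ^+ m * M%:R ^+ (3 * (n - m))) :> R.
      have -> : (3 * n = 3 * m + 3 * (n - m))%N by rewrite -mulnDr subnKC.
      rewrite exprD [(M%:R ^+ 3 * _) ^+ m]exprMn (exprM _ 3 m); field.
      by rewrite expf_neq0 // gt_eqF.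
    apply: ler_wpM2l.
      apply: mulr_ge0; last exact: exprn_ge0.
      apply: divr_ge0; last exact: exprn_ge0.
      apply: mulr_ge0; last exact: exprn_ge0.
      by apply: mulr_ge0; [apply: mulr_ge0; exact: ler0n|exact: mulr_ge0].
    rewrite ler_wpM2r ?exprn_ge0 // lerXn2r ?nnegrE ?mulr_ge0 ?exprn_ge0 //.
  rewrite -mulr_sumr.
  have -> : (302 * 16) * (N%:R * P%:R * M%:R ^+ (3 * n)) * D%:R ^+ 3 =
    (302 * 8) * (N%:R * P%:R * M%:R ^+ (3 * n)) * D%:R ^+ 3 * 2 :> R by ring.
  apply: ler_wpM2l; last exact: geometric_half.
  apply: mulr_ge0; last exact: exprn_ge0.
  apply: mulr_ge0; first by apply: mulr_ge0; exact: ler0n.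
  by apply: mulr_ge0; [exact: mulr_ge0|exact: exprn_ge0].
have := le_trans lo (le_trans hi tot).
have -> : (count p (index_iota 0 N))%:R * (D%:R ^+ 2 / 4) ^+ 3 =
  (count p (index_iota 0 N))%:R * D%:R ^+ 3 / 64 * D%:R ^+ 3 :> R by field.
rewrite ler_pM2r ?exprn_gt0 //; lra.
Qed.

End Counting.

(** * Box dimension and digit sets *)

Section BoxDimension.
Variables (R : realType) (F : set R).
Local Open Scope ereal_scope.

Lemma covering_number_le (delta : R) (k : nat) (c : 'I_k -> R) :
  F `<=` \bigcup_(i in [set: 'I_k]) ball (c i) delta ->
  covering_number F delta <= (k%:R)%:E.
Proof. by move=> h; apply: ereal_inf_lbound; exists k => //; exists c. Qed.

Lemma covering_number_ge0 (delta : R) : 0 <= covering_number F delta.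
Proof. by apply: le_ereal_inf_tmp => _ [k _ <-]; rewrite lee_fin. Qed.

(** Pigeonhole: an open ball of radius [delta] contains at most one of the points. *)
Lemma covering_number_ge (delta : R) (k : nat) (x : 'I_k -> R) :
  (forall i, F (x i)) ->
  (forall i j, i != j -> (2 * delta <= `|x i - x j|)%R) ->
  (k%:R)%:E <= covering_number F delta.
Proof.
move=> Fx sep; apply: le_ereal_inf_tmp => _ [n [c cover] <-].
rewrite lee_fin ler_nat leqNgt; apply/negP => nk.
have ex i : exists j, ball (c j) delta (x i) by have [j _ h] := cover _ (Fx i); exists j.
pose f i := projT1 (cid (ex i)).
have fE i : ball (c (f i)) delta (x i) by rewrite /f; case: cid.
have : ~ injective f.
  by move=> /leq_card; rewrite !card_ord leqNgt nk.
apply=> i j fij; apply/eqP/negP => /negP ne.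
have := fE i; have := fE j; rewrite -fij /ball /= => h1 h2.
have := sep _ _ ne; rewrite leNgt => /negP; apply.
have -> : (x i - x j = (c (f i) - x j) - (c (f i) - x i))%R by ring.
by apply: le_lt_trans (ler_normB _ _) _; move: h1 h2; lra.
Qed.

(** Covers at the scales B^(-n) suffice: replacing [delta] by the next smaller such scale costs one
    factor [Q], a constant that disappears in the limit. *)
Lemma upper_box_dim_le (B : nat) (Q K s : R) :
  (1 < B)%N -> (1 <= Q)%R -> (1 <= K)%R -> ln Q = (s * ln (B%:R))%R ->
  (forall n, (0 < n)%N -> exists k (c : 'I_k -> R),
     F `<=` \bigcup_(i in [set: 'I_k]) ball (c i) ((B%:R ^+ n)^-1)%R /\
     (k%:R <= K * Q ^+ n)%R) ->
  upper_box_dim F <= s%:E.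
Proof.
move=> B1 Q1 K1' lnQ hF; apply/lee_addgt0Pr => eps eps0.
have lnB : (0 < ln (B%:R : R))%R by rewrite ln_gt0 // ltr1n.
have B0 : (0 < B%:R :> R)%R by rewrite ltr0n ltnW.
pose C : R := ln (K * Q)%R.
have C0 : (0 <= C)%R by rewrite ln_ge0 // mulr_ege1.
(* Below [d0], -ln delta exceeds (C + 1)/eps, so the additive constant [C] costs at most [eps] in
   the quotient. *)
pose d0 : R := expR (- (C + 1) / eps)%R.
apply: ge_ereal_inf.
exists (ereal_sup ((fun delta : R =>
  lne (covering_number F delta) * ((- ln delta)^-1)%:E) @` [set d : R | 0 < d < d0]%R)).
  exists [set d : R | 0 < d < d0]%R => //.
  near=> d; apply/andP; split => //; near: d.
  by apply: nbhs_right_lt; exact: expR_gt0.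
apply: ge_ereal_sup => _ [d /= /andP[dp dd] <-].
pose L := (- ln d)%R.
have Lbig : ((C + 1) / eps < L)%R.
  rewrite /L ltrNr -mulNr -(expRK (- (C + 1) / eps)%R) ltr_ln ?posrE //.
  exact: expR_gt0.
have L0 : (0 < L)%R by apply: lt_trans Lbig; rewrite divr_gt0 //; lra.
have exn : exists n, (L <= n%:R * ln B%:R)%R.
  exists (Num.truncn (L / ln B%:R)).+1; rewrite -ler_pdivrMr //; apply: ltW.
  by have /andP[_] := @truncn_itv R (L / ln B%:R) ltac:(by rewrite divr_ge0 ?ltW).
case: (ex_minnP exn) => n hn nmin.
have n0 : (0 < n)%N by case: n hn {nmin} => //; rewrite mul0r leNgt L0.
have nL : (n.-1%:R * ln B%:R < L)%R.
  by rewrite ltNge; apply/negP => /nmin; rewrite leqNgt prednK ?leqnn.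
have [k [c [cover kle]]] := hF n n0.
have dB : ((B%:R ^+ n)^-1 <= d)%R.
  have Bn : (0 < B%:R ^+ n :> R)%R by rewrite exprn_gt0.
  rewrite -[leRHS]invrK lef_pV2 ?posrE ?invr_gt0 // -ler_ln ?posrE ?invr_gt0 //.
  by rewrite lnV ?posrE // lnXn // -[leRHS]mulr_natl.
have KQ0 : (0 < K * Q ^+ n)%R by rewrite mulr_gt0 ?exprn_gt0 //; lra.
have cov : covering_number F d <= (K * Q ^+ n)%:E.
  apply: le_trans (_ : (k%:R)%:E <= _); last by rewrite lee_fin.
  apply: (@covering_number_le _ _ c) => x /cover[i _ h]; exists i => //.
  exact: le_ball h.
have lncov : lne (covering_number F d) <= (ln (K * Q ^+ n))%:E.
  rewrite -lne_EFin // lee_lne //.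
    by rewrite in_itv /= covering_number_ge0 leey.
  by rewrite in_itv /= leey andbT lee_fin ltW.
apply: le_trans (_ : (ln (K * Q ^+ n))%:E * (L^-1)%:E <= _).
  by rewrite lee_pmul2r // lte_fin invr_gt0.
rewrite -EFinM -EFinD lee_fin ler_pdivrMr //.
have -> : (K * Q ^+ n = (K * Q) * Q ^+ n.-1)%R.
  by rewrite -mulrA -exprS prednK.
have Q0 : (0 < Q)%R by lra.
rewrite lnM ?posrE ?mulr_gt0 ?exprn_gt0 //; try lra.
rewrite lnXn // -/C -[(ln Q *+ _)%R]mulr_natl lnQ.
have s0 : (0 <= s)%R.
  by have := ln_ge0 Q1; rewrite lnQ pmulr_lge0.
have t1 : (s * (n.-1%:R * ln B%:R) <= s * L)%R by rewrite ler_wpM2l // ltW.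
have t2 : (C <= eps * L)%R.
  by move: Lbig; rewrite ltr_pdivrMr // [(L * _)%R]mulrC; lra.
have -> : (n.-1%:R * (s * ln B%:R) = s * (n.-1%:R * ln B%:R))%R by ring.
lra.
Unshelve. all: by end_near.
Qed.

Lemma upper_box_dim_ge (s : R) :
  (forall eta : R, 0 < eta -> exists delta : R, 0 < delta < eta /\
     exists k (x : 'I_k -> R),
     [/\ delta < 1, (0 < k)%N, forall i, F (x i),
         forall i j, i != j -> 2 * delta <= `|x i - x j| &
         s * (- ln delta) <= ln k%:R])%R ->
  s%:E <= upper_box_dim F.
Proof.
move=> h; apply: le_ereal_inf_tmp => _ [V V0 <-].
have [eta /= eta0 hV] := V0.
have [d [/andP[d0 deta] [k [x [d1 k0 Fx sep hs]]]]] := h eta eta0.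
apply: le_trans (_ : lne (covering_number F d) * ((- ln d)^-1)%:E <= _); last first.
  apply: ereal_sup_ubound; exists d => //; apply: hV => //=.
  by rewrite sub0r normrN gtr0_norm.
have L0 : (0 < - ln d)%R by rewrite oppr_gt0 ln_lt0 // d0.
apply: le_trans (_ : (ln k%:R)%:E * ((- ln d)^-1)%:E <= _).
  by rewrite -EFinM lee_fin ler_pdivlMr.
rewrite lee_pmul2r ?lte_fin ?invr_gt0 //.
have kp : (0 < k%:R :> R)%R by rewrite ltr0n.
rewrite -lne_EFin // lee_lne //.
- exact: covering_number_ge Fx sep.
- by rewrite in_itv /= leey andbT lee_fin ltW.
- by rewrite in_itv /= covering_number_ge0 leey.
Qed.

End BoxDimension.

Section DigitSet.
Variables (R : realType) (B M : nat).
Hypotheses (M0 : (0 < M)%N) (MB : (M < B)%N).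

Let B0 : 0 < B%:R :> R. Proof. by rewrite ltr0n; lia. Qed.

Lemma digit_set_approx (x : R) n : digit_set B M x ->
  exists f : {ffun 'I_n -> 'I_M}, `|x - digit_point R B f| <= (B%:R ^+ n)^-1.
Proof.
have b0 := B0.
move=> [_ [d [dM cv]]].
pose f := [ffun r : 'I_n => Ordinal (dM r)].
exists f.
have sE : digit_point R B f = series (fun k => (d k)%:R / B%:R ^+ k.+1) n.
  rewrite /series /= big_mkord; apply: eq_bigr => r _; by rewrite ffunE.
have term0 k : 0 <= (d k)%:R / B%:R ^+ k.+1 :> R.
  by rewrite divr_ge0 // exprn_ge0 // ltW.
pose s := series (fun k => (d k)%:R / B%:R ^+ k.+1 : R).
have sS k : s k.+1 = s k + (d k)%:R / B%:R ^+ k.+1.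
  by rewrite /s /series /= big_nat_recr.
(* The tail of a series with digits at most B - 1 is at most B^(-n); subtracting B^(-(n+m)) makes
   the induction close. *)
have bounds m : s n <= s (n + m)%N <= s n + (B%:R ^+ n)^-1 - (B%:R ^+ (n + m))^-1.
  elim: m => [|m /andP[IH1 IH2]]; first by rewrite addn0; lra.
  rewrite addnS sS; have := term0 (n + m)%N => t0.
  apply/andP; split; first by lra.
  have t1 : (d (n + m)%N)%:R / B%:R ^+ (n + m).+1 <=
     (B%:R ^+ (n + m))^-1 - (B%:R ^+ (n + m).+1)^-1 :> R.
    have -> : (B%:R ^+ (n + m))^-1 - (B%:R ^+ (n + m).+1)^-1 =
      (B%:R - 1) / B%:R ^+ (n + m).+1 :> R.
      by rewrite exprS; field; rewrite ?expf_neq0 // gt_eqF.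
    rewrite ler_wpM2r ?invr_ge0 ?exprn_ge0 ?(ltW b0) //.
    by rewrite lerBrDr natr1 ler_nat; have := dM (n + m)%N; lia.
  lra.
rewrite sE -/s ler_norml; apply/andP; split.
  apply: le_trans (_ : 0 <= _); first by rewrite oppr_le0 invr_ge0 exprn_ge0 // ltW.
  rewrite subr_ge0; apply: (cvgr_to_ge cv); exists n => // k /= nk.
  by rewrite -(subnKC nk); case/andP: (bounds (k - n)%N).
rewrite lerBlDl; apply: (cvgr_to_le cv); exists n => // k /= nk.
rewrite -(subnKC nk); case/andP: (bounds (k - n)%N) => _ h; apply: le_trans h _.
by rewrite gerBl invr_ge0 exprn_ge0 // ltW.
Qed.

(** If the fractional part of B^k x is below M/B, the next digit is below [M]. Here [A k] is the
    integer part of B^k x, and the digits are [A k.+1 - B * A k]. *)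
Lemma digit_set_of_frac (x : R) : 0 <= x < 1 ->
  (forall k, exists a : nat, a%:R <= B%:R ^+ k * x < a%:R + M%:R / B%:R) ->
  digit_set B M x.
Proof.
have b0 := B0.
have b1 : 1 <= B%:R :> R by rewrite ler1n; lia.
move=> /andP[x0 x1] hfr; pose A k := projT1 (cid (hfr k)).
have AE k : (A k)%:R <= B%:R ^+ k * x < (A k)%:R + M%:R / B%:R.
  by rewrite /A; case: cid.
have MB1 : M%:R / B%:R < 1 :> R by rewrite ltr_pdivrMr // mul1r ltr_nat.
have A0 : A 0%N = 0%N.
  have /andP[h _] := AE 0%N; rewrite expr0 mul1r in h.
  apply/eqP; rewrite -leqn0 -ltnS -(ltr_nat R); exact: le_lt_trans h x1.
have lo k : (B * A k <= A k.+1)%N.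
  have /andP[h1 _] := AE k; have /andP[_ h2] := AE k.+1.
  rewrite -ltnS -(ltr_nat R) natrM -natr1.
  apply: le_lt_trans (_ : B%:R ^+ k.+1 * x < _); last by lra.
  by rewrite exprS -mulrA ler_pM2l.
have hi k : (A k.+1 < B * A k + M)%N.
  have /andP[_ h1] := AE k; have /andP[h2 _] := AE k.+1.
  rewrite -(ltr_nat R) natrD natrM; apply: le_lt_trans h2 _.
  have -> : M%:R = B%:R * (M%:R / B%:R) :> R by field; rewrite gt_eqF.
  by rewrite exprS -mulrA -mulrDr ltr_pM2l.
split; first by rewrite x0 ltW.
exists (fun k => A k.+1 - B * A k)%N; split.
  by move=> k; have := lo k; have := hi k; lia.
have sE n : series (fun k => (A k.+1 - B * A k)%:R / B%:R ^+ k.+1) n =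
    (A n)%:R / B%:R ^+ n :> R.
  elim: n => [|n IH]; first by rewrite /series /= big_geq // A0 mul0r.
  rewrite /series /= big_nat_recr //= -[\sum_(0 <= k < n) _]/(series _ n) IH.
  rewrite natrB ?lo // natrM exprS; field.
  by rewrite ?expf_neq0 // gt_eqF.
apply/cvgrPdist_le => eps eps0; near=> n; rewrite sE.
have Bn : 0 < B%:R ^+ n :> R by rewrite exprn_gt0.
have -> : x - (A n)%:R / B%:R ^+ n = (B%:R ^+ n * x - (A n)%:R) / B%:R ^+ n.
  by field; rewrite gt_eqF.
have /andP[h1 h2] := AE n.
rewrite ger0_norm; last by rewrite divr_ge0 ?subr_ge0 // ltW.
rewrite ler_pdivrMr //; apply: le_trans (_ : 1 <= _); first by lra.
have nB : n%:R <= B%:R ^+ n :> R.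
  by rewrite -natrX ler_nat ltnW // ltn_expl // (leq_ltn_trans M0 MB).
apply: le_trans (_ : eps * n%:R <= _); last by rewrite ler_pM2l.
rewrite mulrC -ler_pdivrMr // mul1r.
near: n; exact: nbhs_infty_ger.
Unshelve. all: by end_near.
Qed.

End DigitSet.

(** * Points with steered digits *)

(** Walk from [x] in steps of length [h] and stop on reaching the next integer: the overshoot is
    less than one step, and the distance walked is at most 1 + h. *)
Lemma steer (R : realType) (x h : R) : 0 <= x -> 0 < h ->
  exists k c : nat, k%:R * h <= 1 + h /\ c%:R <= x + k%:R * h < c%:R + h.
Proof.
move=> x0 h0; have /andP[t1 t2] := truncn_itv x0.
set c := (Num.truncn x).+1 in t2.
have c1 : c%:R <= x + 1 by rewrite -natr1 lerD2r.
have exk : exists k, c%:R <= x + k%:R * h.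
  exists (Num.truncn ((c%:R - x) / h)).+1; rewrite -lerBlDl -ler_pdivrMr //; apply: ltW.
  by have /andP[_] := @truncn_itv R ((c%:R - x) / h) ltac:(by rewrite divr_ge0 ?subr_ge0 // ltW).
case: (ex_minnP exk) => k hk kmin; exists k, c.
case: k hk kmin => [|k] hk kmin; first by move: hk; rewrite mul0r addr0 leNgt t2.
have : x + k%:R * h < c%:R.
  by rewrite ltNge; apply/negP => /kmin; rewrite ltnn.
rewrite -natr1 mulrDl mul1r in hk * => h1; split; first lra.
by apply/andP; split; lra.
Qed.

Lemma nested_intervals (R : realType) (lo hi : nat -> R) :
  (forall m, lo m <= lo m.+1) -> (forall m, hi m.+1 <= hi m) ->
  (forall m, lo m <= hi m) -> exists u, forall m, lo m <= u <= hi m.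
Proof.
move=> hl hh lh.
have ml : {homo lo : m n / (m <= n)%N >-> m <= n} by apply/nondecreasing_seqP.
have mh : {homo hi : m n / (m <= n)%N >-> n <= m} by apply/nonincreasing_seqP.
have lohi m n : lo m <= hi n.
  have [mn|nm] := leqP m n; first exact: le_trans (ml _ _ mn) (lh n).
  by apply: le_trans (lh m) (mh _ _ (ltnW nm)).
have sl : has_sup (range lo).
  by split; [exists (lo 0%N), 0%N|exists (hi 0%N) => _ [m _ <-]].
exists (sup (range lo)) => m; apply/andP; split.
  by apply: ub_le_sup; [case: sl|exists m].
by apply: ge_sup; [exists (lo 0%N), 0%N|move=> _ [k _ <-]].
Qed.

Lemma mixed_digit_lt A q k i : (100 <= A)%N -> (q < A ^ 6)%N -> (k < A ^ 6)%N ->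
  (i < A ^ 2)%N -> (q + i + k * A ^ 6 < A ^ 13)%N.
Proof.
move=> hA hq hk hi; have A0 : (0 < A)%N by apply: leq_trans hA.
have h12 : (k * A ^ 6 <= A ^ 12)%N.
  by rewrite (expnD A 6 6) leq_mul2r (ltnW hk) orbT.
have h6 : (A ^ 6 <= A ^ 12)%N by apply: leq_pexp2l.
have h2 : (A ^ 2 <= A ^ 12)%N by apply: leq_pexp2l.
have h13 : (3 * A ^ 12 <= A ^ 13)%N.
  by rewrite (expnS A 12) leq_mul2r (leq_trans _ hA) ?orbT.
move: (A ^ 13)%N (A ^ 12)%N (A ^ 6)%N (A ^ 2)%N (k * _)%N h12 h6 h2 h13 hq hi.
by clear; lia.
Qed.

(** Controls the error in the expansion of the cube of [v + s] in [steered_step], where [jy] and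
    [js] stand for the digit times [y] and times [s]; 22 = 15 + 6 + 1. *)
Lemma cube_error_le (R : realType) (d w y v s jy js : R) :
  0 <= w <= 2 -> 0 <= y <= 1 -> 0 <= v <= 2 -> 0 <= s <= 1 -> 0 <= jy <= d ->
  0 <= js <= d -> 0 <= (6 * w + 3 * y) * jy + 3 * v * js + js * s <= 22 * d.
Proof.
move=> /andP[w0 w2] /andP[y0 y1] /andP[v0 v2] /andP[s0 s1] /andP[jy0 jyd] /andP[js0 jsd].
have k0 : 0 <= 6 * w + 3 * y <= 15 by apply/andP; split; lra.
have l0 : 0 <= 3 * v <= 6 by apply/andP; split; lra.
move: (6 * w + _) (3 * v) k0 l0 => k l /andP[k0 k15] /andP[l0 l6].
have e1 : k * jy <= 15 * d by apply: ler_pM.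
have e2 : l * js <= 6 * d by apply: ler_pM.
have e3 : js * s <= d * 1 by apply: ler_pM.
have p1 : 0 <= k * jy by exact: mulr_ge0.
have p2 : 0 <= l * js by exact: mulr_ge0.
have p3 : 0 <= js * s by exact: mulr_ge0.
by apply/andP; split; lra.
Qed.

(** With [D] a multiple of [u - v], the two products are the same multiple of u^2 - v^2 and of u^3 -
    v^3. *)
Lemma factored_powers_le (R : realType) (u v D d : R) :
  0 <= D -> D <= d -> 1 <= u <= 2 -> 1 <= v <= 2 ->
  0 <= D * (u + v) <= 4 * d /\ 0 <= D * (u * u + u * v + v * v) <= 12 * d.
Proof.
move=> D0 Dd /andP[u1 u2] /andP[v1 v2].
have u0 : 0 <= u by lra.
have v0 : 0 <= v by lra.
have uu : u * u <= 2 * 2 by apply: ler_pM.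
have uv : u * v <= 2 * 2 by apply: ler_pM.
have vv : v * v <= 2 * 2 by apply: ler_pM.
have uu0 : 0 <= u * u by exact: mulr_ge0.
have uv0 : 0 <= u * v by exact: mulr_ge0.
have vv0 : 0 <= v * v by exact: mulr_ge0.
have scale r c : 0 <= r -> r <= c -> 0 <= D * r <= c * d.
  by move=> r0 rc; rewrite mulr_ge0 //= mulrC; apply: ler_pM.
by split; apply: scale; lra.
Qed.

Section Steering.
Variables (R : realType) (A : nat).
Hypothesis hA : (100 <= A)%N.
Local Notation B := (A ^ 30)%N.
Let a : R := A%:R.
Let z : R := a^-1.

Let a_ge : 100 <= a. Proof. rewrite /a ler_nat; exact: hA. Qed.
Let a0 : 0 < a. Proof. by have := a_ge; lra. Qed.
Let z0 : 0 < z. Proof. by rewrite invr_gt0 a0. Qed.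
Let zle : z <= 1 / 100.
Proof. by rewrite /z -[1 / 100]invrK invf_div divr1 lef_pV2 ?posrE ?a0 // a_ge. Qed.
Let az : a * z = 1. Proof. by rewrite /z mulfV // gt_eqF // a0. Qed.
Let aXz k l : (l <= k)%N -> a ^+ l * z ^+ k = z ^+ (k - l).
Proof. by move=> lk; rewrite -{1}(subnKC lk) exprD mulrA -exprMn az expr1n mul1r. Qed.
Let zX k l : (l <= k)%N -> z ^+ k <= z ^+ l.
Proof. by move=> lk; apply: ler_wiXn2l => //; have := z0; have := zle; lra. Qed.
Let zXS k : z ^+ k.+1 <= z ^+ k / 100.
Proof.
have h0 := z0; have h := zle; rewrite exprS mulrC ler_wpM2l ?exprn_ge0 ?(ltW h0) //.
by rewrite -[_^-1]mul1r.
Qed.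
Let zXp k : 0 < z ^+ k. Proof. by rewrite exprn_gt0 // z0. Qed.
Let BE : B%:R = a ^+ 30. Proof. by rewrite natrX. Qed.
Let Bp : 0 < B%:R :> R. Proof. by rewrite BE exprn_gt0 // a0. Qed.
Let B2 : 2 <= B%:R :> R.
Proof.
have ha := a_ge; rewrite BE; apply: le_trans (_ : a ^+ 1 <= _).
  by rewrite expr1; lra.
by apply: ler_weXn2l => //; lra.
Qed.
Let zX1 k : z ^+ k <= 1.
Proof. by rewrite -(expr0 z); exact: zX. Qed.
Let Bz n : (B%:R ^+ n)^-1 = z ^+ (30 * n) :> R.
Proof. by rewrite BE -exprM /z exprVn. Qed.

Let w : R := 1 + z ^+ 6.

Definition near_nat (x r : R) := exists c : nat, c%:R <= x < c%:R + r.

(** [v] is a truncation of the final point. The slack [2 * a ^+ 13 / B ^+ n.+1] bounds all later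
    digits, each being below A^13, and z^17 is A^13/B. The threshold z^3 / 2 is half of the
    admissible M/B = A^(-3); the other half is spent on the tail when passing to the limit. *)
Definition steered (n p : nat) : Prop :=
  let v : R := p%:R / B%:R ^+ n in
  [/\ w <= v, v + 2 * a ^+ 13 / B%:R ^+ n.+1 <= w + z ^+ 17,
      near_nat (B%:R ^+ n * v ^+ 2) (z ^+ 3 / 2) &
      near_nat (B%:R ^+ n * v ^+ 3) (z ^+ 3 / 2)].

Let p1 := (A ^ 30 + A ^ 24)%N.

Lemma steered_base : steered 1 p1.
Proof.
have vE : p1%:R / B%:R ^+ 1 = w.
  rewrite expr1 /w natrD !natrX -/a mulrDl divff ?expf_neq0 ?gt_eqF ?a0 //.
  by rewrite -exprVn -/z aXz.
rewrite /steered vE expr1; split=> //.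
- rewrite lerD2l Bz -mulrA aXz //.
  have := zX (isT : (46 <= 30 * 2 - 13)%N).
  have := zXp 45; have := zXS 45; have := zX (isT : (17 <= 45)%N); lra.
- exists (A ^ 30 + 2 * A ^ 24 + A ^ 18)%N.
  have -> : B%:R * w ^+ 2 = (A ^ 30 + 2 * A ^ 24 + A ^ 18)%:R.
    have -> : (B + 2 * A ^ 24 + A ^ 18)%:R = a ^+ 30 + 2 * a ^+ 24 + a ^+ 18.
      by rewrite /a; ring.
    rewrite BE /w.
    have -> : a ^+ 24 = a ^+ 30 * z ^+ 6.
      by rewrite -[in RHS](subnKC (_ : 6 <= 30)%N) // exprD mulrAC -exprMn az expr1n mul1r.
    have -> : a ^+ 18 = a ^+ 30 * z ^+ 12.
      by rewrite -[in RHS](subnKC (_ : 12 <= 30)%N) // exprD mulrAC -exprMn az expr1n mul1r.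
    by ring.
  by rewrite lexx /= ltrDl divr_gt0 ?zXp.
- exists (A ^ 30 + 3 * A ^ 24 + 3 * A ^ 18 + A ^ 12)%N.
  have -> : B%:R * w ^+ 3 = (A ^ 30 + 3 * A ^ 24 + 3 * A ^ 18 + A ^ 12)%:R.
    have -> : (B + 3 * A ^ 24 + 3 * A ^ 18 + A ^ 12)%:R =
        a ^+ 30 + 3 * a ^+ 24 + 3 * a ^+ 18 + a ^+ 12.
      by rewrite /a; ring.
    rewrite BE /w.
    have -> : a ^+ 24 = a ^+ 30 * z ^+ 6.
      by rewrite -[in RHS](subnKC (_ : 6 <= 30)%N) // exprD mulrAC -exprMn az expr1n mul1r.
    have -> : a ^+ 18 = a ^+ 30 * z ^+ 12.
      by rewrite -[in RHS](subnKC (_ : 12 <= 30)%N) // exprD mulrAC -exprMn az expr1n mul1r.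
    have -> : a ^+ 12 = a ^+ 30 * z ^+ 18.
      by rewrite -[in RHS](subnKC (_ : 18 <= 30)%N) // exprD mulrAC -exprMn az expr1n mul1r.
    by ring.
  by rewrite lexx /= ltrDl divr_gt0 ?zXp.
Qed.

Lemma near_nat_add (x r r' d : R) : near_nat x r -> 0 <= d -> r + d <= r' ->
  near_nat (x + d) r'.
Proof. by move=> [c /andP[h1 h2]] d0 hr; exists c; apply/andP; split; lra. Qed.

Lemma near_natD (x r : R) (m : nat) : near_nat x r -> near_nat (m%:R + x) r.
Proof.
by move=> [c /andP[h1 h2]]; exists (m + c)%N; rewrite natrD; apply/andP; split; lra.
Qed.

(* The digit is [j = q + k A^6]: modulo 1 the increments of [B^(n+1) v^2] and
   [B^(n+1) v^3] are about [2 q / A^6] and [6 q / A^6 + 3 k / A^6], so [q] is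
   chosen to place the square and then [k] to place the cube. *)
Lemma steered_step n p : (0 < n)%N -> steered n p ->
  exists J : nat -> nat,
    [/\ forall i, (i < A ^ 2)%N -> (J i < A ^ 13)%N,
        forall i, (i < A ^ 2)%N -> steered n.+1 (B * p + J i) &
        forall i i', (i < A ^ 2)%N -> (i' < A ^ 2)%N -> J i = J i' -> i = i'].
Proof.
have ha := a_ge; have h0 := z0; have hz := zle.
move=> n0; rewrite /steered; set v : R := p%:R / _.
move=> [vlo vhi [c2 /andP[l2 u2]] [c3 /andP[l3 u3]]].
have e6 : a ^+ 6 * z ^+ 6 = 1 by rewrite -exprMn az expr1n.
set eps := z ^+ 6 in e6.
have eps0 : 0 < eps by exact: zXp.
set x2 := B%:R * (B%:R ^+ n * v ^+ 2 - c2%:R).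
set x3 := B%:R * (B%:R ^+ n * v ^+ 3 - c3%:R).
have x20 : 0 <= x2 by rewrite mulr_ge0 ?(ltW Bp) // subr_ge0.
have x30 : 0 <= x3 by rewrite mulr_ge0 ?(ltW Bp) // subr_ge0.
have [q0 [d2 [q0le hd2]]] := @steer R x2 (2 * eps) x20 ltac:(lra).
have steer3 q : exists k : nat, k%:R * (3 * eps) <= 1 + 3 * eps /\
    near_nat (x3 + (6 * eps + 3 * eps ^+ 2) * q%:R + k%:R * (3 * eps)) (3 * eps).
  have y0 : 0 <= x3 + (6 * eps + 3 * eps ^+ 2) * q%:R.
    by rewrite addr_ge0 // mulr_ge0 // addr_ge0 ?mulr_ge0 ?exprn_ge0 // ltW.
  have [k [c [h1 h2]]] := @steer R _ (3 * eps) y0 ltac:(lra).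
  by exists k; split=> //; exists c.
pose k q := projT1 (cid (steer3 q)).
have kE q : (k q)%:R * (3 * eps) <= 1 + 3 * eps /\
    near_nat (x3 + (6 * eps + 3 * eps ^+ 2) * q%:R + (k q)%:R * (3 * eps)) (3 * eps).
  by rewrite /k; case: cid.
have A0 : (0 < A)%N by apply: leq_trans hA.
have small (m : nat) : m%:R * (2 * eps) <= 1 + 2 * eps -> (m < A ^ 6)%N.
  move=> hm; rewrite -(ltr_nat R) natrX -/a.
  rewrite -(ltr_pM2r eps0) e6.
  have : eps <= 1 / 100.
    have := zXS 5; have := zX (isT : (0 <= 5)%N); rewrite expr0 -/eps; lra.
  lra.
have q0A : (q0 < A ^ 6)%N by exact: small.
have kA q : (k q < A ^ 6)%N.
  apply: small; have [h _] := kE q.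
  have : (k q)%:R * (2 * eps) <= (k q)%:R * (3 * eps).
    by rewrite ler_wpM2l //; lra.
  have kk : 0 <= (k q)%:R * eps by rewrite mulr_ge0 // ltW.
  lra.
(* The freedom of A^2 choices: moving [q] from [q0] to [q0 + i] shifts the square by at most 2
   A^(-4), well below A^(-3) / 2, and for each [q] a [k] of its own corrects the cube. *)
pose J i := (q0 + i + k (q0 + i) * A ^ 6)%N.
have A2 : (A ^ 2 < A ^ 6)%N by rewrite ltn_exp2l //; apply: leq_trans hA.
have JA i : (i < A ^ 2)%N -> (J i < A ^ 13)%N.
  by move=> iA; apply: mixed_digit_lt.
exists J; split=> //; last first.
  (* [J i] is congruent to [q0 + i] modulo A^6, and [i] is below A^6. *)
  move=> i i' iA i'A /(congr1 (modn^~ (A ^ 6)%N)); rewrite /J.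
  rewrite -![(_ + k _ * _)%N](addnC (k _ * _)%N) !modnMDl => /eqP.
  by rewrite eqn_modDl !modn_small ?(ltn_trans _ A2) // => /eqP.
move=> i iA; have jA := JA i iA.
pose q := (q0 + i)%N; set j := J i in jA *.
clear JA small kA q0A A2 q0le x20 x30 l2 u2 l3 u3.
have jE : j%:R = q%:R + (k q)%:R * a ^+ 6 :> R by rewrite /j /J natrD natrM natrX.
have jeps : j%:R * eps = q%:R * eps + (k q)%:R :> R.
  by rewrite jE mulrDl -mulrA e6 mulr1.
have j0 : 0 <= j%:R :> R by [].
have jle : j%:R <= a ^+ 13 by rewrite /a -natrX ler_nat ltnW.
set s : R := j%:R / B%:R ^+ n.+1.
have v'E : (B * p + j)%:R / B%:R ^+ n.+1 = v + s.
  rewrite natrD natrM mulrDl /s; congr (_ + _).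
  by rewrite exprS /v; field; rewrite ?expf_neq0 // gt_eqF.
have s0 : 0 <= s by rewrite divr_ge0 // exprn_ge0 // ltW.
have zpow : (B%:R ^+ n.+1)^-1 <= z ^+ 60.
  by rewrite Bz; apply: zX; exact: (@leq_mul 30 2 30 n.+1).
have sle : s <= z ^+ 47.
  have -> : z ^+ 47 = a ^+ 13 * z ^+ 60 by rewrite aXz.
  by apply: ler_pM => //; rewrite invr_ge0 exprn_ge0 // ltW.
pose y := v - w.
have y0 : 0 <= y by rewrite subr_ge0.
have t13 : 0 <= 2 * a ^+ 13 / B%:R ^+ n.+1.
  by rewrite divr_ge0 ?mulr_ge0 ?exprn_ge0 ?(ltW a0) ?(ltW Bp).
have yle : y <= z ^+ 17 by rewrite /y; lra.
have z4 := zXp 4.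
have jy : j%:R * y <= z ^+ 4.
  have -> : z ^+ 4 = a ^+ 13 * z ^+ 17 by rewrite aXz.
  by apply: ler_pM.
have js : j%:R * s <= z ^+ 4.
  apply: le_trans (_ : a ^+ 13 * z ^+ 47 <= _); first by apply: ler_pM.
  by rewrite aXz //; apply: zX.
have z31 : z ^+ 4 <= z ^+ 3 / 100 by exact: zXS.
have z3 := zXp 3.
have jyp : 0 <= j%:R * y by rewrite mulr_ge0.
have jsp : 0 <= j%:R * s by rewrite mulr_ge0.
have epsz : eps <= z ^+ 4 by apply: zX.
have Bs : B%:R ^+ n.+1 * s = j%:R.
  by rewrite /s mulrC divfK // expf_neq0 // gt_eqF.
have vE : v = 1 + eps + y by rewrite /y /w -/eps; ring.
have v2 : v <= 2.
  have := zX (isT : (1 <= 17)%N); have := zX (isT : (1 <= 6)%N); rewrite expr1 -/eps.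
  by lra.
have s1 : s <= 1.
  exact: le_trans sle (zX1 47).
have y1 : y <= 1.
  exact: le_trans yle (zX1 17).
rewrite v'E; split.
- by apply: le_trans vlo _; rewrite lerDl.
- have : 2 * a ^+ 13 / B%:R ^+ n.+2 <= a ^+ 13 / B%:R ^+ n.+1.
    have -> : 2 * a ^+ 13 / B%:R ^+ n.+2 = 2 / B%:R * (a ^+ 13 / B%:R ^+ n.+1).
      by rewrite [B%:R ^+ n.+2]exprS; field; rewrite ?expf_neq0 // ?gt_eqF.
    rewrite ler_piMl ?divr_ge0 ?exprn_ge0 ?(ltW a0) ?(ltW Bp) //.
    rewrite ler_pdivrMr // mul1r; exact: B2.
  have : s <= a ^+ 13 / B%:R ^+ n.+1.
    by rewrite ler_wpM2r // invr_ge0 exprn_ge0 // ltW.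
  move: vhi; rewrite -mulrA; move: (a ^+ 13 / _) => b13; lra.
(* As A^6 [eps] = 1, the part k A^6 of the digit adds the integer 2 k to [2 * j * eps]: the choice
   of [k] does not disturb the square. *)
- have -> : B%:R ^+ n.+1 * (v + s) ^+ 2 =
     (B * c2 + 2 * j + 2 * k q)%:R + ((x2 + q0%:R * (2 * eps)) +
       (i%:R * (2 * eps) + 2 * (j%:R * y) + j%:R * s)).
    have -> : B%:R ^+ n.+1 * (v + s) ^+ 2 =
      B%:R * (B%:R ^+ n * v ^+ 2) + 2 * v * (B%:R ^+ n.+1 * s) + (B%:R ^+ n.+1 * s) * s.
      by rewrite exprS; ring.
    have -> : 2 * v * (B%:R ^+ n.+1 * s) =
        2 * j%:R + 2 * (q%:R * eps + (k q)%:R) + 2 * (j%:R * y).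
      by rewrite -jeps Bs vE; ring.
    by rewrite Bs /x2 /q; move: (k _) (B%:R ^+ n * _) => kq r; ring.
  apply: near_natD; apply: near_nat_add (_ : near_nat _ (2 * eps)) _ _.
  + by exists d2.
  + apply: addr_ge0 => //; apply: addr_ge0; apply: mulr_ge0 => //.
    by apply: mulr_ge0 => //; exact: ltW.
  + have : i%:R * (2 * eps) <= 2 * z ^+ 4.
      have -> : z ^+ 4 = a ^+ 2 * eps by rewrite /eps aXz.
      have : i%:R <= a ^+ 2 by rewrite /a -natrX ler_nat ltnW.
      move=> ia; have : i%:R * eps <= a ^+ 2 * eps by rewrite ler_wpM2r // ltW.
      by lra.
    by lra.
(* Here 6 [eps] + 3 [eps]^2 multiplies the digit, so k A^6 contributes the integer 6 k and the shift
   3 k [eps], which is what [k] was chosen for. *)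
- have -> : B%:R ^+ n.+1 * (v + s) ^+ 3 =
     (B * c3 + 3 * j + 6 * k q)%:R +
      ((x3 + (6 * eps + 3 * eps ^+ 2) * q%:R + (k q)%:R * (3 * eps)) +
       ((6 * w + 3 * y) * (j%:R * y) + 3 * v * (j%:R * s) + j%:R * s * s)).
    have -> : B%:R ^+ n.+1 * (v + s) ^+ 3 =
      B%:R * (B%:R ^+ n * v ^+ 3) + 3 * v ^+ 2 * (B%:R ^+ n.+1 * s)
      + 3 * v * (B%:R ^+ n.+1 * s * s) + (B%:R ^+ n.+1 * s) * s * s.
      by rewrite exprS; ring.
    have -> : 3 * v ^+ 2 * (B%:R ^+ n.+1 * s) = 3 * j%:R
        + (6 + 3 * eps) * (q%:R * eps + (k q)%:R) + (6 * w + 3 * y) * (j%:R * y).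
      by rewrite -jeps Bs vE /w -/eps; ring.
    by rewrite Bs /x3; move: (k q) (B%:R ^+ n * _) => kq r; ring.
  have w0 : 0 <= w by rewrite addr_ge0 // ltW.
  have v0 : 0 <= v by exact: le_trans vlo.
  have w2 : w <= 2 by apply: le_trans vlo v2.
  have /andP[err0 errle] : 0 <= (6 * w + 3 * y) * (j%:R * y) + 3 * v * (j%:R * s)
      + j%:R * s * s <= 22 * z ^+ 4.
    by apply: cube_error_le; [rewrite w0|rewrite y0|rewrite v0|rewrite s0|rewrite jyp|rewrite jsp].
  apply: near_natD; apply: near_nat_add (kE q).2 err0 _.
  by lra.
Qed.

(** The intervals with left end the truncation and length [2 * a ^+ 13 / B ^+ m.+2] are nested: the
    new digit uses at most half of the length, and the new interval, shorter by a factor B at least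
    2, fits into the other half. *)
Lemma steered_limit (p : nat -> nat) : (forall m, steered m.+1 (p m)) ->
  (forall m, exists2 j, (j < A ^ 13)%N & p m.+1 = (B * p m + j)%N) ->
  exists u : R, forall m,
    (p m)%:R / B%:R ^+ m.+1 <= u <= (p m)%:R / B%:R ^+ m.+1 + 2 * a ^+ 13 / B%:R ^+ m.+2.
Proof.
move=> hs hp; have b0 := Bp.
have Bn n : 0 < B%:R ^+ n :> R by rewrite exprn_gt0.
have a13 : 0 < a ^+ 13 by rewrite exprn_gt0 // a0.
have pE m j : p m.+1 = (B * p m + j)%N ->
    (p m.+1)%:R / B%:R ^+ m.+2 = (p m)%:R / B%:R ^+ m.+1 + j%:R / B%:R ^+ m.+2 :> R.
  move=> ->; rewrite natrD natrM mulrDl; congr (_ + _).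
  by rewrite [B%:R ^+ m.+2]exprS; field; rewrite ?expf_neq0 // gt_eqF.
apply: nested_intervals => m.
- have [j _ /pE ->] := hp m.
  by rewrite lerDl divr_ge0 // ltW.
- have [j jA /pE ->] := hp m.
  have : j%:R / B%:R ^+ m.+2 <= a ^+ 13 / B%:R ^+ m.+2.
    by rewrite ler_wpM2r ?invr_ge0 ?(ltW (Bn _)) // /a -natrX ler_nat ltnW.
  have : 2 * a ^+ 13 / B%:R ^+ m.+3 <= a ^+ 13 / B%:R ^+ m.+2.
    have -> : 2 * a ^+ 13 / B%:R ^+ m.+3 = 2 / B%:R * (a ^+ 13 / B%:R ^+ m.+2).
      by rewrite [B%:R ^+ m.+3]exprS; field; rewrite ?expf_neq0 // ?gt_eqF.
    rewrite ler_piMl ?divr_ge0 ?(ltW (Bn _)) ?(ltW a13) //.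
    rewrite ler_pdivrMr // mul1r; exact: B2.
  rewrite -[2 * a ^+ 13 / B%:R ^+ m.+2]mulrA.
  move: (2 * a ^+ 13 / _) (a ^+ 13 / _) (j%:R / _) ((p m)%:R / _) => r1 r2 r3 r4; lra.
- rewrite lerDl; apply: divr_ge0; last exact: ltW.
  by apply: mulr_ge0 => //; exact: ltW.
Qed.

Lemma limit_near_nat (p : nat -> nat) (u : R) : (forall m, steered m.+1 (p m)) ->
  (forall m, (p m)%:R / B%:R ^+ m.+1 <= u <=
     (p m)%:R / B%:R ^+ m.+1 + 2 * a ^+ 13 / B%:R ^+ m.+2) ->
  1 <= u <= 1 + 1 / 100 /\
  forall k, [/\ near_nat (B%:R ^+ k * u) (z ^+ 3), near_nat (B%:R ^+ k * u ^+ 2) (z ^+ 3)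
     & near_nat (B%:R ^+ k * u ^+ 3) (z ^+ 3)].
Proof.
move=> hs hu; have b0 := Bp.
have z3 := zXp 3; have z31 : z ^+ 4 <= z ^+ 3 / 100 := zXS 3.
have z5 : z ^+ 5 <= z ^+ 4 / 100 := zXS 4; have z4 := zXp 4; have z5p := zXp 5.
have z6 := zXp 6.
have z65 : z ^+ 6 <= z ^+ 5 by exact: zX.
have z17 : z ^+ 17 <= z ^+ 5 by exact: zX.
have z30 : z ^+ 3 <= 1 / 100.
  have := zX (isT : (1 <= 3)%N); rewrite expr1; have := zle; lra.
have [u1 u2] : 1 + z ^+ 6 <= u /\ u <= 1 + z ^+ 6 + z ^+ 17.
  have /andP[h1 h2] := hu 0%N; have [h3 h4 _ _] := hs 0%N.
  by split; [exact: le_trans h3 h1|exact: le_trans h2 h4].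
have ulo : 1 <= u by lra.
have uhi : u <= 1 + 2 * z ^+ 5 by lra.
split; first by apply/andP; split; lra.
have uhi' : u <= 1 + 1 / 100 by lra.
have u12 : 1 <= u <= 2 by rewrite ulo; lra.
(* Level 0 is not covered by [steered]; there [u] and its powers have integer part 1 and a small
   remainder, as [u - 1] is at most 2 A^(-5). *)
case=> [|m].
  have [] := @factored_powers_le R u 1 (u - 1) (2 * z ^+ 5); try lra.
  move=> /andP[e2 f2] /andP[e3 f3].
  have E2 : u ^+ 2 = 1 + (u - 1) * (u + 1) by ring.
  have E3 : u ^+ 3 = 1 + (u - 1) * (u * u + u * 1 + 1 * 1) by ring.
  rewrite expr0 !mul1r E2 E3; split; exists 1%N; apply/andP.
  - by split; lra.
  - by split; [rewrite lerDl|rewrite ltrD2l; apply: le_lt_trans f2 _; lra].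
  - by split; [rewrite lerDl|rewrite ltrD2l; apply: le_lt_trans f3 _; lra].
have /andP[h1 h2] := hu m; have [h3 _ sq cu] := hs m.
move: h1 h2 h3 sq cu; set v := _ / _ => h1 h2 h3 sq cu.
have vlo' : 1 + z ^+ 6 <= v := h3.
have v12 : 1 <= v <= 2 by apply/andP; split; lra.
have sq' : near_nat (B%:R ^+ m.+1 * v ^+ 2) (z ^+ 3 / 2) := sq.
have cu' : near_nat (B%:R ^+ m.+1 * v ^+ 3) (z ^+ 3 / 2) := cu.
set D := B%:R ^+ m.+1 * (u - v).
have Bm : 0 < B%:R ^+ m.+1 :> R by rewrite exprn_gt0.
have D0 : 0 <= D by rewrite mulr_ge0 ?subr_ge0 // ltW.
have Dle : D <= 2 * z ^+ 17.
  apply: le_trans (_ : B%:R ^+ m.+1 * (2 * a ^+ 13 / B%:R ^+ m.+2) <= _).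
    by rewrite ler_pM2l // lerBlDl.
  have -> : B%:R ^+ m.+1 * (2 * a ^+ 13 / B%:R ^+ m.+2) = 2 * (a ^+ 13 * (B%:R ^+ 1)^-1).
    by rewrite [B%:R ^+ m.+2]exprS expr1; field; rewrite ?expf_neq0 // gt_eqF.
  by rewrite Bz aXz.
have Dz : D <= 2 * z ^+ 5 by apply: le_trans Dle _; rewrite ler_pM2l.
have small : 12 * (2 * z ^+ 5) <= z ^+ 3 / 2 by lra.
have small' : 4 * (2 * z ^+ 5) <= z ^+ 3 / 2 by lra.
have half r : r <= z ^+ 3 / 2 -> z ^+ 3 / 2 + r <= z ^+ 3.
  by lra.
have [/andP[e2 f2] /andP[e3 f3]] := factored_powers_le D0 Dz u12 v12.
split.
- have -> : B%:R ^+ m.+1 * u = (p m)%:R + D.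
    by rewrite /D /v; field; rewrite ?expf_neq0 // gt_eqF.
  exists (p m); rewrite lerDl D0 ltrD2l /=; apply: le_lt_trans Dz _; lra.
- have -> : B%:R ^+ m.+1 * u ^+ 2 = B%:R ^+ m.+1 * v ^+ 2 + D * (u + v) by rewrite /D; ring.
  exact: near_nat_add sq' e2 (half _ (le_trans f2 small')).
- have -> : B%:R ^+ m.+1 * u ^+ 3 = B%:R ^+ m.+1 * v ^+ 3 + D * (u * u + u * v + v * v).
    by rewrite /D; ring.
  exact: near_nat_add cu' e3 (half _ (le_trans f3 small)).
Qed.

(** A tree with A^2 branches at every node, [c] being the sequence of choices. Digits are below [B],
    so division by [B] recovers the parent node and the digit; a node therefore determines the
    choices that lead to it. *)
Lemma steered_tree : exists p : (nat -> nat) -> nat -> nat,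
  [/\ forall c, (forall k, (c k < A ^ 2)%N) -> forall m, steered m.+1 (p c m),
      forall c, (forall k, (c k < A ^ 2)%N) ->
        forall m, exists2 j, (j < A ^ 13)%N & p c m.+1 = (B * p c m + j)%N &
      forall c c', (forall k, (c k < A ^ 2)%N) -> (forall k, (c' k < A ^ 2)%N) ->
        forall m, p c m = p c' m -> forall k, (k < m)%N -> c k = c' k].
Proof.
have AB : (A ^ 13 <= B)%N by apply: leq_pexp2l => //; apply: leq_trans hA.
have ex (mq : nat * nat) : exists J : nat -> nat, steered mq.1.+1 mq.2 ->
    [/\ forall i, (i < A ^ 2)%N -> (J i < A ^ 13)%N,
        forall i, (i < A ^ 2)%N -> steered mq.1.+2 (B * mq.2 + J i) &
        forall i i', (i < A ^ 2)%N -> (i' < A ^ 2)%N -> J i = J i' -> i = i'].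
  (* A single choice function on all pairs is wanted; at pairs that are not steered [id] is a dummy
     value. *)
  have [st|nst] := pselect (steered mq.1.+1 mq.2); last by exists id.
  by have [J hJ] := steered_step (ltn0Sn _) st; exists J.
have [J hJ] := choice ex.
pose p c := fix p m := if m is m'.+1 then (B * p m' + J (m', p m') (c m'))%N
                       else (A ^ 30 + A ^ 24)%N.
have st c : (forall k, (c k < A ^ 2)%N) -> forall m, steered m.+1 (p c m).
  move=> hc; elim=> [|m IH]; first exact: steered_base.
  by have [_ h _] := hJ (m, p c m) IH; apply: h.
have lt c : (forall k, (c k < A ^ 2)%N) -> forall m, (J (m, p c m) (c m) < A ^ 13)%N.
  by move=> hc m; have [h _ _] := hJ (m, p c m) (st c hc m); apply: h.
exists p; split=> //.
  by move=> c hc m; exists (J (m, p c m) (c m)) => //; apply: lt.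
move=> c c' hc hc'; elim=> [//|m IH] /= E k.
have j1 := leq_trans (lt c hc m) AB; have j2 := leq_trans (lt c' hc' m) AB.
have B0 : (0 < B)%N by apply: leq_trans j1.
have pp : p c m = p c' m.
  have := congr1 (divn^~ B) E; rewrite /= !(mulnC B) !divnMDl //.
  by rewrite !divn_small // !addn0.
have JJ : J (m, p c m) (c m) = J (m, p c m) (c' m).
  by move: E; rewrite -pp => /addnI.
have [_ _ inj] := hJ (m, p c m) (st c hc m).
rewrite ltnS leq_eqVlt => /predU1P[->|]; first exact: inj.
exact: IH.
Qed.

Lemma separated_points m : exists x : {ffun 'I_m -> 'I_(A ^ 2)} -> R,
  (forall c, 1 <= x c <= 1 + 1 / 100 /\
    forall k, [/\ near_nat (B%:R ^+ k * x c) (z ^+ 3),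
                  near_nat (B%:R ^+ k * x c ^+ 2) (z ^+ 3)
                & near_nat (B%:R ^+ k * x c ^+ 3) (z ^+ 3)]) /\
  (forall c c', c != c' -> 2 / B%:R ^+ m.+2 <= `|x c - x c'|).
Proof.
have b0 := Bp.
have [p [pst pstep pinj]] := steered_tree.
have A2 : (0 < A ^ 2)%N by rewrite expn_gt0 (leq_trans _ hA).
(* A word of length [m] is continued by the choice 0 for ever. *)
pose ext (c : {ffun 'I_m -> 'I_(A ^ 2)}) (k : nat) : nat :=
  if insub k is Some i then c i else 0%N.
have extlt c k : (ext c k < A ^ 2)%N.
  by rewrite /ext; case: insubP => [i _ _|_] //; exact: ltn_ord.
have extE c (i : 'I_m) : ext c i = c i :> nat by rewrite /ext (valK i).
have exu c := steered_limit (pst _ (extlt c)) (pstep _ (extlt c)).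
pose x c := projT1 (cid (exu c)).
have xE c : forall k, (p (ext c) k)%:R / B%:R ^+ k.+1 <= x c <=
   (p (ext c) k)%:R / B%:R ^+ k.+1 + 2 * a ^+ 13 / B%:R ^+ k.+2.
  by rewrite /x; case: cid.
exists x; split.
  move=> c; exact: limit_near_nat (pst _ (extlt c)) (xE c).
have Bi : B%:R^-1 = z ^+ 30 by rewrite -[B%:R]expr1 Bz.
(* Distinct words have distinct numerators at level [m], hence truncations at least B^(-m-1) apart;
   the tail takes away only a small fraction of this. *)
have key c c' : (p (ext c) m < p (ext c') m)%N -> 2 / B%:R ^+ m.+2 <= x c' - x c.
  move=> lt; have /andP[_ h1] := xE c m; have /andP[h2 _] := xE c' m.
  have Bm : 0 < B%:R ^+ m.+1 :> R by rewrite exprn_gt0.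
  have h3 : (p (ext c) m)%:R / B%:R ^+ m.+1 + 1 / B%:R ^+ m.+1 <=
      (p (ext c') m)%:R / B%:R ^+ m.+1 :> R.
    by rewrite -mulrDl ler_pM2r ?invr_gt0 // natr1 ler_nat.
  have -> : 2 / B%:R ^+ m.+2 = 2 * z ^+ 30 * (1 / B%:R ^+ m.+1).
    by rewrite [B%:R ^+ m.+2]exprS invfM Bi; move: (z ^+ 30) => r; ring.
  have E : 2 * a ^+ 13 / B%:R ^+ m.+2 = 2 * z ^+ 17 * (1 / B%:R ^+ m.+1).
    have -> : z ^+ 17 = a ^+ 13 * z ^+ 30 by rewrite aXz.
    rewrite [B%:R ^+ m.+2]exprS invfM Bi.
    by move: (z ^+ 30) (a ^+ 13) => r r'; ring.
  rewrite E in h1.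
  have r0 : 0 < 1 / B%:R ^+ m.+1 :> R by rewrite divr_gt0.
  have q1 : 2 * z ^+ 30 * (1 / B%:R ^+ m.+1) <= 1 / 10 * (1 / B%:R ^+ m.+1).
    rewrite ler_wpM2r ?(ltW r0) //; have := zX (isT : (1 <= 30)%N).
    rewrite expr1; have := zle; lra.
  have q2 : 2 * z ^+ 17 * (1 / B%:R ^+ m.+1) <= 1 / 10 * (1 / B%:R ^+ m.+1).
    rewrite ler_wpM2r ?(ltW r0) //; have := zX (isT : (1 <= 17)%N).
    rewrite expr1; have := zle; lra.
  move: (1 / B%:R ^+ m.+1) r0 q1 q2 h1 h3 h2 => r *; lra.
move=> c c' ne; have [lt|lt|E] := ltngtP (p (ext c) m) (p (ext c') m).
- by rewrite distrC; apply: le_trans (ler_norm _); exact: key.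
- by apply: le_trans (ler_norm _); exact: key.
case/eqP: ne; apply/ffunP => i.
have := pinj _ _ (extlt c) (extlt c') _ E i (ltn_ord i).
by rewrite !extE => /val_inj.
Qed.

End Steering.

(** * The two dimension bounds *)

Section LowerBound.
Variables (R : realType) (A : nat) (F : set R).
Hypothesis hA : (100 <= A)%N.
Hypothesis hF : forall t : R, 0 < t < 1 -> digit_set (A ^ 30) (A ^ 27) t ->
  digit_set (A ^ 30) (A ^ 27) (t ^+ 2) -> digit_set (A ^ 30) (A ^ 27) (t ^+ 3) -> F t.

Lemma digit_ratio : (A ^ 27)%:R / (A ^ 30)%:R = A%:R^-1 ^+ 3 :> R.
Proof.
have A0 : A%:R != 0 :> R by rewrite pnatr_eq0 -lt0n (leq_trans _ hA).
rewrite -[30%N]/(27 + 3)%N expnD natrM invfM mulrA divff ?mul1r ?natrX ?exprVn //.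
by rewrite expf_neq0.
Qed.

(** Division by B^i inserts leading zeros: before place [i] the scaled value is at most 2/B, which
    is below A^(-3), and from there on it is B^(k-i) y. With t = u/B this serves u, u^2 and u^3 for
    i = 1, 2, 3. *)
Lemma digit_set_shift (y : R) i : 0 <= y <= 2 -> (0 < i)%N ->
  (forall k, near_nat ((A ^ 30)%:R ^+ k * y) (A%:R^-1 ^+ 3)) ->
  digit_set (A ^ 30) (A ^ 27) (y / (A ^ 30)%:R ^+ i).
Proof.
move=> /andP[y0 y2] i0 hy.
have A0 : (0 < A)%N by apply: leq_trans hA.
have A1 : (1 < A)%N by apply: leq_trans hA.
have a0 : 0 < A%:R :> R by rewrite ltr0n.
set b : R := (A ^ 30)%:R.
have bE : b = A%:R ^+ 30 by rewrite /b natrX.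
have b0 : 0 < b by rewrite bE exprn_gt0.
have b1 : 1 <= b by rewrite bE exprn_ege1 // ler1n.
have z3 : 2 / b < A%:R^-1 ^+ 3.
  rewrite ltr_pdivrMr // bE -[30%N]/(3 + 27)%N exprD mulrA -exprMn mulVf ?gt_eqF //.
  rewrite expr1n mul1r; apply: lt_le_trans (_ : A%:R ^+ 1 <= _).
    by rewrite expr1 (ltr_nat R 2 A) (leq_trans _ hA).
  by apply: ler_weXn2l => //; rewrite ler1n.
have low k : (k < i)%N -> b ^+ k * (y / b ^+ i) <= 2 / b.
  move=> ki; have -> : b ^+ i = b ^+ (i - k.+1) * (b * b ^+ k).
    by rewrite -exprS -exprD subnK.
  have -> : b ^+ k * (y / (b ^+ (i - k.+1) * (b * b ^+ k))) = (y / b) / b ^+ (i - k.+1).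
    by field; rewrite ?expf_neq0 // gt_eqF.
  apply: le_trans (_ : y / b <= _); last by rewrite ler_pM2r ?invr_gt0.
  by rewrite ler_pdivrMr ?exprn_gt0 // ler_peMr ?exprn_ege1 // divr_ge0 // ltW.
have q0 k : 0 <= b ^+ k * (y / b ^+ i).
  by rewrite mulr_ge0 ?divr_ge0 // exprn_ge0 // ltW.
apply: digit_set_of_frac; first by rewrite expn_gt0 A0.
- by rewrite ltn_exp2l.
- have h := low 0%N i0; rewrite expr0 mul1r in h.
  have h' := q0 0%N; rewrite expr0 mul1r in h'.
  rewrite h' /=; apply: le_lt_trans h _; apply: lt_le_trans z3 _.
  by rewrite exprn_ile1 // ?invr_ge0 ?(ltW a0) // invf_le1 // ler1n.
move=> k; rewrite digit_ratio -/b; have [ki|ik] := ltnP k i.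
  by exists 0%N; rewrite q0 /= add0r; apply: le_lt_trans (low k ki) z3.
have -> : b ^+ k * (y / b ^+ i) = b ^+ (k - i) * y; last exact: hy.
rewrite -{1}(subnK ik) exprD; field; rewrite expf_neq0 // gt_eqF //.
Qed.

Lemma upper_box_dim_lower : ((1 / 30)%:E <= upper_box_dim F)%E.
Proof.
apply: upper_box_dim_ge => eta eta0.
have A0 : (0 < A)%N by apply: leq_trans hA.
have A1 : (1 < A)%N by apply: leq_trans hA.
have a0 : 0 < A%:R :> R by rewrite ltr0n.
set b : R := (A ^ 30)%:R.
have bE : b = A%:R ^+ 30 by rewrite /b natrX.
have b0 : 0 < b by rewrite bE exprn_gt0.
have b2 : 100 <= b.
  apply: le_trans (_ : A%:R ^+ 1 <= _); first by rewrite expr1 ler_nat; exact: hA.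
  by rewrite bE; apply: ler_weXn2l => //; rewrite ler1n.
(* Large enough for B^(-m-3) < [eta], and at least 3: the count A^(2m) beats the power 1/30 of
   B^(m+3), which is A^(m+3), as soon as m + 3 <= 2 m. *)
pose m := (Num.truncn eta^-1).+3.
have bm : 0 < b ^+ (m + 3) by rewrite exprn_gt0.
have big : eta^-1 < b ^+ (m + 3).
  apply: lt_le_trans (truncnS_gt _) _.
  apply: le_trans (_ : (m + 3)%:R <= _); first by rewrite ler_nat (leq_trans _ (leq_addr _ _)) // /m leqW.
  by rewrite /b -natrX ler_nat ltnW // ltn_expl // -{1}(expn0 A) ltn_exp2l.
have [x [xgood xsep]] := separated_points R hA m.
exists (b ^+ (m + 3))^-1; split.
  by rewrite invr_gt0 bm /= -[eta]invrK ltf_pV2 ?posrE ?invr_gt0.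
exists #|{ffun 'I_m -> 'I_(A ^ 2)}|, (fun i => x (enum_val i) / b); split.
- by rewrite invf_lt1 // exprn_egt1 ?addnS //; lra.
- by rewrite card_ffun !card_ord !expn_gt0 A0.
- move=> i; have [/andP[x1 x2] xk] := xgood (enum_val i).
  move: (x _) x1 x2 xk => y y1 y2 yk.
  have yy : y * y <= (1 + 1 / 100) * (1 + 1 / 100) by apply: ler_pM; lra.
  have yy0 : 0 <= y * y by rewrite mulr_ge0; lra.
  have yyy : y * y * y <= (1 + 1 / 100) * (1 + 1 / 100) * (1 + 1 / 100).
    by apply: ler_pM => //; lra.
  have yyy0 : 0 <= y * y * y by rewrite mulr_ge0; lra.
  apply: hF.
  + rewrite divr_gt0 //=; last by lra.
    by rewrite ltr_pdivrMr //; lra.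
  + rewrite -[b]expr1; apply: digit_set_shift => // [|k]; first lra.
    by have [] := yk k.
  + rewrite expr_div_n; apply: digit_set_shift => // [|k].
      by rewrite expr2; lra.
    by have [] := yk k.
  + rewrite expr_div_n; apply: digit_set_shift => // [|k].
      by rewrite exprSr expr2; lra.
    by have [] := yk k.
- move=> i j ij; rewrite -mulrBl normrM (gtr0_norm (_ : 0 < b^-1)) ?invr_gt0 //.
  have -> : 2 * (b ^+ (m + 3))^-1 = 2 / b ^+ m.+2 * b^-1.
    by rewrite addn3 [b ^+ m.+3]exprS invfM; ring.
  rewrite ler_pM2r ?invr_gt0 //; apply: xsep.
  by rewrite (inj_eq enum_val_inj).
- have lnA : 0 < ln (A%:R : R) by rewrite ln_gt0 // ltr1n.
  rewrite lnV ?posrE // opprK card_ffun !card_ord bE -exprM lnXn //.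
  rewrite -expnM natrX lnXn // -[ln _ *+ (30 * _)]mulr_natl -[ln _ *+ (2 * _)]mulr_natl.
  have -> : (30 * (m + 3))%:R = 30 * (m%:R + 3) :> R by rewrite (natrM R 30) (natrD R m).
  have -> : (2 * m)%:R = 2 * m%:R :> R by rewrite (natrM R 2).
  have m3 : 3 <= m%:R :> R by rewrite (ler_nat R 3 m).
  have : 0 <= (m%:R - 3) * ln (A%:R : R) by rewrite mulr_ge0 ?subr_ge0 // ltW.
  move: (ln _) (m%:R) => l mm; lra.
Qed.

End LowerBound.

Section UpperBound.
Variables (R : realType) (P M D0 Q : nat) (W : R) (F : set R).
Local Notation B := (P ^ 3)%N.
Hypothesis P1 : (1 < P)%N.
Hypothesis BD : B = (100 * D0)%N.
Hypothesis M0 : (0 < M)%N.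
Hypothesis MB : (M < B)%N.
Hypothesis Q0 : (0 < Q)%N.
Hypothesis MQ : (M ^ 3 = B ^ 2 * Q)%N.
Hypothesis hW : 2 * M%:R + 2 * B%:R * \sum_(0 <= j < B) j%:R^-1 <= W.
Hypothesis hWM : 2 * W ^+ 3 <= M%:R ^+ 3 * P%:R.
Hypothesis hF : forall t : R, F t -> 0 <= t < 1 /\ [/\ digit_set B M t,
  digit_set B M (t ^+ 2) & digit_set B M (t ^+ 3)] \/ t = 1.

Let C : R := 302 * 16 * 64 * 100 ^+ 3 * P%:R.

(** On [0, 1] the square and the cube move by at most 3 (t - x), so a distance [n] at [t] becomes at
    most 3 n + n at the grid point. *)
Lemma dist_grid (t x : R) (p : R) n : 0 <= x -> x <= t -> t <= 1 -> t - x <= n ->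
  [/\ `|t - p| <= n -> `|x - p| <= 4 * n,
      `|t ^+ 2 - p| <= n -> `|x ^+ 2 - p| <= 4 * n &
      `|t ^+ 3 - p| <= n -> `|x ^+ 3 - p| <= 4 * n].
Proof.
move=> x0 xt t1 tx.
have h (u v c : R) : 0 <= v - u <= 3 * n -> `|v - c| <= n -> `|u - c| <= 4 * n.
  by move=> /andP[h1 h2]; rewrite !ler_norml => /andP[h3 h4]; apply/andP; split; lra.
have n0 : 0 <= n by lra.
have step s : 0 <= s -> s <= 3 -> 0 <= (t - x) * s <= 3 * n.
  move=> s0 s3; rewrite mulr_ge0 ?subr_ge0 //= [leRHS]mulrC.
  by apply: ler_pM; rewrite ?subr_ge0.
have tt : t * t <= 1 * 1 by apply: ler_pM; lra.
have xx : x * x <= 1 * 1 by apply: ler_pM; lra.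
have xt1 : t * x <= 1 * 1 by apply: ler_pM; lra.
have tt0 : 0 <= t * t by rewrite mulr_ge0; lra.
have xx0 : 0 <= x * x by rewrite mulr_ge0; lra.
have tx0 : 0 <= t * x by rewrite mulr_ge0; lra.
split; apply: h.
- by have := step 1; rewrite mulr1; apply; lra.
- have -> : t ^+ 2 - x ^+ 2 = (t - x) * (t + x) by ring.
  by apply: step; lra.
- have -> : t ^+ 3 - x ^+ 3 = (t - x) * (t * t + t * x + x * x) by ring.
  by apply: step; lra.
Qed.

Lemma digit_curve_cover n : (0 < n)%N -> exists k (c : 'I_k -> R),
  F `<=` \bigcup_(i in [set: 'I_k]) ball (c i) ((B%:R ^+ n)^-1) /\
  k%:R <= (C + 1) * Q%:R ^+ n.
Proof.
move=> n0.
have B0 : (0 < B)%N by rewrite expn_gt0 ltnW.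
have N0 : (0 < B ^ n)%N by rewrite expn_gt0 B0.
set N := (B ^ n)%N.
have Np : 0 < N%:R :> R by rewrite ltr0n.
have NE : B%:R ^+ n = N%:R :> R by rewrite -natrX.
pose p (a : nat) := `[< exists t : R, [/\ 0 <= t < 1, digit_set B M t,
  digit_set B M (t ^+ 2), digit_set B M (t ^+ 3) & a%:R / N%:R <= t < a.+1%:R / N%:R] >].
(* Degree N/100 respects the frequency restriction and still resolves the scale 1/N: a distance of
   4/N becomes 4/100, below the 1/24 needed for the kernels. *)
pose D := (D0 * B ^ n.-1)%N.
have ND : N = (100 * D)%N by rewrite mulnA -BD -expnS prednK.
have DN : D%:R = N%:R / 100 :> R by rewrite ND natrM; field.
pose G := seq.filter p (index_iota 0 N).
have cnt : (size G)%:R <= C * Q%:R ^+ n.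
  rewrite size_filter.
  have := @digit_curve_count R P M n D W P1 ND hW hWM p.
  set lhs := (count p _)%:R; move=> h.
  have {}h : lhs * D%:R ^+ 3 <= 302 * 16 * 64 * (N%:R * P%:R * M%:R ^+ (3 * n)).
    apply: h => a aN /asboolP[t [/andP[t0 t1] d1 d2 d3 /andP[at1 at2]]].
    have [f1 e1] := digit_set_approx M0 MB n d1.
    have [f2 e2] := digit_set_approx M0 MB n d2.
    have [f3 e3] := digit_set_approx M0 MB n d3.
    exists f1, f2, f3.
    have tn : t - a%:R / N%:R <= (B%:R ^+ n)^-1.
      rewrite NE lerBlDl; apply: le_trans (ltW at2) _.
      by rewrite -natr1 mulrDl mul1r.
    have x0 : 0 <= a%:R / N%:R :> R by rewrite divr_ge0.
    have small u : `|u| <= 4 * (B%:R ^+ n)^-1 -> `|u| * D%:R <= 1 / 24 :> R.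
      move=> hu; apply: le_trans (_ : 4 * (B%:R ^+ n)^-1 * D%:R <= _).
        by rewrite ler_wpM2r.
      have -> : 4 * (B%:R ^+ n)^-1 * D%:R = 4 / 100 :> R.
        by rewrite NE DN; field; rewrite gt_eqF.
      lra.
    split; apply: small.
    - by have [h _ _] := dist_grid (digit_point R B f1) x0 at1 (ltW t1) tn; apply: h.
    - by have [_ h _] := dist_grid (digit_point R B f2) x0 at1 (ltW t1) tn; apply: h.
    - by have [_ _ h] := dist_grid (digit_point R B f3) x0 at1 (ltW t1) tn; apply: h.
  have ME : M%:R ^+ (3 * n) = N%:R ^+ 2 * Q%:R ^+ n :> R.
    by rewrite exprM -(natrX R M 3) MQ natrM (natrX R _ 2) exprMn exprAC NE.
  have N3 : 0 < N%:R ^+ 3 :> R by rewrite exprn_gt0.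
  rewrite -(ler_pM2r N3); move: h; rewrite ME DN.
  have -> : (N%:R / 100) ^+ 3 = N%:R ^+ 3 / 100 ^+ 3 :> R by rewrite expr_div_n.
  rewrite (mulrA lhs) ler_pdivrMr ?exprn_gt0 // => h; apply: le_trans h _.
  by rewrite le_eqVlt; apply/orP; left; apply/eqP; rewrite /C; ring.
(* The last index lies beyond the list, so [nth] returns its default 1: this ball covers the
   exceptional point t = 1. *)
exists (size G).+1, (fun i => nth 1 [seq a%:R / N%:R | a <- G] i); split.
  move=> t /hF[[/andP[t0 t1] [d1 d2 d3]]|->]; last first.
    exists ord_max => //; rewrite /ball /= nth_default ?size_map //.
    by rewrite subrr normr0 NE invr_gt0.
  have tN : 0 <= t * N%:R by rewrite mulr_ge0 // ltW.
  have /andP[a1 a2] := truncn_itv tN; set a := Num.truncn _ in a1 a2.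
  have b1 : a%:R / N%:R <= t by rewrite ler_pdivrMr.
  have b2 : t < a.+1%:R / N%:R by rewrite ltr_pdivlMr.
  have aN : (a < N)%N.
    by rewrite -(ltr_nat R); apply: le_lt_trans a1 _; rewrite gtr_pMl.
  have aG : a \in G.
    rewrite mem_filter mem_index_iota aN /= andbT; apply/asboolP; exists t.
    by split; rewrite ?t0 ?b1.
  have iG : (index a G < (size G).+1)%N by rewrite ltnS index_size.
  exists (Ordinal iG) => //.
  rewrite /ball /= (nth_map 0%N) ?index_mem // nth_index //.
  rewrite distrC ger0_norm ?subr_ge0 // NE ltrBlDl.
  by move: b2; rewrite -natr1 mulrDl mul1r.
have Q1 : 1 <= Q%:R ^+ n :> R by rewrite exprn_ege1 // ler1n.
by rewrite -natr1 mulrDl mul1r lerD.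
Qed.

Lemma upper_box_dim_upper (s : R) : ln (Q%:R) = s * ln (B%:R) -> (upper_box_dim F <= s%:E)%E.
Proof.
move=> lnQ; apply: (upper_box_dim_le (B := B) (Q := Q%:R) (K := C + 1)) => //.
- by rewrite (leq_trans P1) // -{1}(expn1 P) leq_pexp2l // ltnW.
- by rewrite ler1n.
- rewrite lerDr; apply: mulr_ge0; last exact: ler0n.
  apply: mulr_ge0; last exact: exprn_ge0.
  by do 2 (apply: mulr_ge0; last exact: ler0n); exact: ler0n.
- exact: digit_curve_cover.
Qed.

End UpperBound.

(** * Fractional parts and the concrete constants *)

Lemma frac_part_id (R : realType) (x : R) : 0 <= x < 1 -> frac_part x = x.
Proof.
move=> h; rewrite /frac_part (_ : Num.floor x = 0) ?subr0 //.
by apply: floor_def; rewrite add0r.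
Qed.

Lemma frac_part_nat (R : realType) (n : nat) : frac_part (n%:R : R) = 0.
Proof.
rewrite /frac_part (_ : Num.floor _ = n%:Z) ?subrr //.
by apply: floor_def; rewrite lexx /= intrD ltrDl.
Qed.

Lemma digit_set0 (R : realType) (B M : nat) : (0 < M)%N -> (M < B)%N ->
  digit_set B M (0 : R).
Proof.
move=> M0 MB; apply: digit_set_of_frac => //; first by rewrite lexx ltr01.
move=> k; exists 0%N; rewrite mulr0 lexx /= add0r divr_gt0 ?ltr0n //.
exact: ltn_trans MB.
Qed.

(** All parameters are powers of one E: B = E^120 and M = E^108, with A = E^4 below and P = E^40, Q
    = E^84, W = E^121 above. W is B times E, so a single factor E absorbs the logarithm of [B]; Q
    gives the dimension 84/120 = 7/10. *)
Lemma digit_curve_dim (R : realType) (E e0 r : nat) (F : set R) :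
  (0 < e0)%N -> E = (100 * e0)%N -> (E ^ 120 <= 2 ^ r)%N -> (4 * r <= E)%N ->
  (forall t, 0 < t < 1 -> digit_set (E ^ 120) (E ^ 108) t ->
    digit_set (E ^ 120) (E ^ 108) (t ^+ 2) ->
    digit_set (E ^ 120) (E ^ 108) (t ^+ 3) -> F t) ->
  (forall t, F t -> 0 <= t < 1 /\ [/\ digit_set (E ^ 120) (E ^ 108) t,
    digit_set (E ^ 120) (E ^ 108) (t ^+ 2) &
    digit_set (E ^ 120) (E ^ 108) (t ^+ 3)] \/ t = 1) ->
  ((1 / 30)%:E <= upper_box_dim F <= (7 / 10)%:E)%E.
Proof.
move=> e00 Ee Er rE hlo hup.
have hE : (100 <= E)%N by rewrite Ee leq_pmulr.
have E1 : (1 < E)%N by apply: leq_trans hE.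
have E0 : (0 < E)%N by apply: ltnW.
apply/andP; split.
  apply: (@upper_box_dim_lower R (E ^ 4)); last by rewrite -!expnM.
  by apply: leq_trans hE _; rewrite -{1}(expn1 E) leq_pexp2l.
have EB : ((E ^ 40) ^ 3 = E ^ 120)%N by rewrite -expnM.
have x0 : 0 < E%:R :> R by rewrite ltr0n.
have x100 : 100 <= E%:R :> R by rewrite (ler_nat R 100 E).
apply: (@upper_box_dim_upper R (E ^ 40) (E ^ 108) (e0 * E ^ 119) (E ^ 84)
         (E%:R ^+ 121)); rewrite ?EB //.
- by rewrite -{1}(expn0 E) ltn_exp2l.
- by rewrite mulnA -Ee -expnS.
- by rewrite expn_gt0 E0.
- by rewrite ltn_exp2l.
- by rewrite expn_gt0 E0.
- by rewrite -!expnM -expnD.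
- have harm : \sum_(0 <= j < E ^ 120) j%:R^-1 <= r%:R :> R.
    apply: le_trans (harmonic_bound R r).
    rewrite [leRHS](big_cat_nat _ _ (n := (E ^ 120)%N)) //= lerDl.
    by apply: sumr_ge0 => j _; rewrite invr_ge0.
  have r4 : 4 * r%:R <= E%:R :> R by rewrite -natrM ler_nat.
  rewrite !natrX.
  have y0 : 0 < E%:R ^+ 120 :> R by rewrite exprn_gt0.
  have yy : E%:R ^+ 108 <= E%:R ^+ 120 :> R.
    by apply: ler_weXn2l => //; rewrite ler1n.
  rewrite [E%:R ^+ 121]exprS.
  move: (E%:R ^+ 120) (E%:R ^+ 108) y0 yy => y y' y0 yy.
  have t1 : y * (\sum_(0 <= j < E ^ 120) j%:R^-1) <= y * (E%:R / 4).
    by rewrite ler_pM2l //; lra.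
  have t2 : 100 * y <= E%:R * y by rewrite ler_pM2r.
  lra.
- rewrite !natrX -!exprM -exprD.
  (* The exponents leave one spare factor E, which pays for the 2 in [hWM]. *)
  have -> : (108 * 3 + 40 = (121 * 3).+1)%N by [].
  rewrite exprS ler_pM2r ?exprn_gt0 //; lra.
- rewrite !natrX !lnXn // -[ln _ *+ 84]mulr_natl -[ln _ *+ 120]mulr_natl.
  by move: (ln _) => l; field.
Qed.

Lemma ten_power_bounds k : (6 <= k <= 100)%N -> exists e0 r,
  [/\ (0 < e0)%N, (10 ^ k = 100 * e0)%N, ((10 ^ k) ^ 120 <= 2 ^ r)%N
    & (4 * r <= 10 ^ k)%N].
Proof.
move=> /andP[k6 k100]; exists (10 ^ (k - 2))%N, (4 * k * 120)%N; split.
- by rewrite expn_gt0.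
- by rewrite -[100%N]/(10 ^ 2)%N -expnD subnKC //; apply: leq_trans k6.
(* The value of [r] comes from 10 <= 2^4. *)
- by rewrite expnM leq_exp2r // expnM leq_exp2r // (leq_trans _ k6).
- apply: leq_trans (_ : 10 ^ 4 * 10 ^ 2 <= _)%N; last by rewrite -expnD leq_exp2l.
  have -> : (4 * (4 * k * 120) = 1920 * k)%N by lia.
  by apply: leq_mul => //; vm_compute.
Qed.

Theorem theoremA (R : realType) :
  exists l : nat,
    let S : set R := [set t : R | [/\ 0 < t,
        K1 (frac_part (10 ^+ (9000 * l) * t)),
        K1 (frac_part (10 ^+ (9000 * l) * t ^+ 2)) &
        K1 (frac_part (10 ^+ (9000 * l) * t ^+ 3))]] in
    infinite_set S /\
    ((1 / 30)%:E <= upper_box_dim (S `&` `[0%R, 1%R]) <= (7 / 10)%:E)%E.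
Proof.
exists 0%N; rewrite muln0 expr0.
have -> : @K1 R = digit_set ((10 ^ 75) ^ 120) ((10 ^ 75) ^ 108).
  by rewrite /K1 -!expnM; congr (digit_set (10 ^ _) (10 ^ _)).
have := @ten_power_bounds 75 isT; move: (10 ^ 75)%N => E [e0 [r [e00 Ee Er rE]]].
have E1 : (1 < E)%N by rewrite Ee (@leq_trans 100) ?leq_pmulr.
have MB : (E ^ 108 < E ^ 120)%N by rewrite ltn_exp2l.
have M0 : (0 < E ^ 108)%N by rewrite expn_gt0 (ltnW E1).
split.
  (* The positive integers already form an infinite subset: their fractional parts are 0, and 0 is a
     digit point. *)
  pose f (n : nat) : R := n.+1%:R.
  move=> /(@finite_preimage _ _ _ f) fin; apply: infinite_nat.
  have finj : injective f by move=> m n /eqP; rewrite eqr_nat eqSS => /eqP.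
  have := fin (in2W finj); congr finite_set; apply/seteqP; split=> // n _ /=.
  rewrite !mul1r /f -!natrX !frac_part_nat ltr0n.
  by split=> //; exact: digit_set0.
apply: (digit_curve_dim e00 Ee Er rE) => t.
  move=> /andP[t0 t1] d1 d2 d3.
  have xp k : 0 <= t ^+ k.+1 < 1 by rewrite exprn_ge0 ?exprn_ilt1 ?ltW.
  split; last by rewrite /= in_itv /= !ltW.
  by rewrite /= !mul1r !frac_part_id ?xp //; rewrite ltW.
move=> [/= [t0 d1 d2 d3]]; rewrite in_itv /= => /andP[_].
(* At t = 1 the fractional part is 0 rather than [t], so this point is kept apart as the exceptional
   one. *)
rewrite le_eqVlt => /predU1P[->|t1]; [by right|left].
have xp k : 0 <= t ^+ k.+1 < 1 by rewrite exprn_ge0 ?exprn_ilt1 ?ltW.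
move: d1 d2 d3; rewrite !mul1r !frac_part_id ?xp ?(ltW t0) //.
Qed.
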